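(* Let $\mathfrak C:X'Y'\to Z$ be a quantum multiple access channel (a quantum channel from $X'\otimes Y'$ to $Z$, finite-dimensional). Let $\mathcal X,\mathcal Y$ be finite sets, for each $x\in\mathcal X$ let $\sigma_x^{X'}$ be a state on $X'$ and for each $y\in\mathcal Y$ let $\sigma^{Y'}_y$ be a state on $Y'$, and let $p(x)p(y)$ be a product probability distribution on $\mathcal X\times\mathcal Y$. Let $$\rho^{XYZ}:=\sum_{x,y}p(x)p(y)|x,y\rangle\langle x,y|^{XY}\otimes\mathfrak C(\sigma^{X'}_x\otimes\sigma^{Y'}_y).$$ Let $0<\epsilon<1$ and $R_1,R_2$ satisfy $R_1\le I^\epsilon_H(X:YZ)_\rho-1-\log\frac1\epsilon$, $R_2\le I^\epsilon_H(Y:XZ)_\rho-1-\log\frac1\epsilon$, $R_1+R_2\le I^\epsilon_H(XY:Z)_\rho-1-\log\frac1\epsilon$. Then there exists an $(R_1,R_2,49\epsilon^{1/2})$-quantum MAC code for sending classical information through $\mathfrak C$.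
   Context: $I^\epsilon_H(X:YZ)_\rho:=D^\epsilon_H(\rho^{XYZ}\|\rho^X\otimes\rho^{YZ})$, $I^\epsilon_H(Y:XZ)_\rho:=D^\epsilon_H(\rho^{XYZ}\|\rho^Y\otimes\rho^{XZ})$, $I^\epsilon_H(XY:Z)_\rho:=D^\epsilon_H(\rho^{XYZ}\|\rho^{XY}\otimes\rho^Z)$, where $D^\epsilon_H(\alpha\|\beta):=\max_\Pi -\log_2\operatorname{Tr}[\Pi\beta]$ over POVM elements $0\le\Pi\le\mathbb 1$ with $\operatorname{Tr}[\Pi\alpha]\ge1-\epsilon$; logs are base 2. An $(R_1,R_2,\eta)$-quantum MAC code for classical information through $\mathfrak C$ consists of an encoding of each message $m_1\in[2^{R_1}]$ into a state $\alpha_{m_1}$ on $X'$, of each $m_2\in[2^{R_2}]$ into a state $\beta_{m_2}$ on $Y'$, and a POVM $\{\Lambda_{m_1,m_2}\}$ on $Z$ such that the average decoding error $2^{-(R_1+R_2)}\sum_{m_1,m_2}\operatorname{Tr}[(\mathbb 1-\Lambda_{m_1,m_2})\mathfrak C(\alpha_{m_1}\otimes\beta_{m_2})]$ is at most $\eta$. *)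

(* Defs.v *)
From HB Require Import structures.
From mathcomp Require Import all_boot all_order all_algebra.
Set Implicit Arguments. Unset Strict Implicit. Unset Printing Implicit Defensive.
Import Order.TTheory GRing.Theory Num.Theory.
Local Open Scope ring_scope.

Section QDefs.
Variable C : numClosedFieldType.

(* Index bijection 'I_m * 'I_n <-> 'I_(m*n): pairing is [mxvec_index],
   unpairing is its inverse. *)
Definition unidx (m n : nat) (k : 'I_(m * n)) : 'I_m * 'I_n :=
  enum_val (cast_ord (esym (mxvec_cast m n)) k).

Definition adjmx (m n : nat) (A : 'M[C]_(m, n)) : 'M[C]_(n, m) :=
  (map_mx Num.conj A)^T.

Definition psd (n : nat) (A : 'M[C]_n) : Prop :=
  forall v : 'cV[C]_n, 0 <= (adjmx v *m A *m v) 0 0.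

Definition is_state (n : nat) (A : 'M[C]_n) : Prop := psd A /\ \tr A = 1.

Definition povm_elem (n : nat) (P : 'M[C]_n) : Prop := psd P /\ psd (1%:M - P).

Definition kron (m n : nat) (A : 'M[C]_m) (B : 'M[C]_n) : 'M[C]_(m * n) :=
  \matrix_(i, j) (A (unidx i).1 (unidx j).1 * B (unidx i).2 (unidx j).2).

(* id_k (x) Phi applied to an operator on C^k (x) C^n. *)
Definition ampl (n m k : nat) (Phi : 'M[C]_n -> 'M[C]_m) (M : 'M[C]_(k * n))
  : 'M[C]_(k * m) :=
  \matrix_(r, s)
    (Phi (\matrix_(a, b) M (mxvec_index (unidx r).1 a) (mxvec_index (unidx s).1 b)))
      (unidx r).2 (unidx s).2.

Definition is_channel (n m : nat) (Phi : 'M[C]_n -> 'M[C]_m) : Prop :=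
  [/\ linear Phi,
      (forall (k : nat) (M : 'M[C]_(k * n)), psd M -> psd (ampl Phi M))
    & forall A, \tr (Phi A) = \tr A].

Definition is_distr (n : nat) (p : 'I_n -> C) : Prop :=
  (forall i, 0 <= p i) /\ \sum_i p i = 1.

Definition idx3 (a b c : nat) (x : 'I_a) (y : 'I_b) (z : 'I_c) : 'I_(a * b * c) :=
  mxvec_index (mxvec_index x y) z.

Definition ent3 (a b c : nat) (M : 'M[C]_(a * b * c)) x y z x' y' z' : C :=
  M (@idx3 a b c x y z) (@idx3 a b c x' y' z').

Definition mk3 (a b c : nat)
  (F : 'I_a -> 'I_b -> 'I_c -> 'I_a -> 'I_b -> 'I_c -> C) : 'M[C]_(a * b * c) :=
  \matrix_(i, j)
    F (unidx (unidx i).1).1 (unidx (unidx i).1).2 (unidx i).2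
      (unidx (unidx j).1).1 (unidx (unidx j).1).2 (unidx j).2.

(* rho^X (x) rho^{YZ}, rho^Y (x) rho^{XZ}, rho^{XY} (x) rho^Z, written on XYZ,
   with the marginals given by partial traces. *)
Definition marg_X_YZ (a b c : nat) (M : 'M[C]_(a * b * c)) : 'M[C]_(a * b * c) :=
  mk3 (fun x y z x' y' z' =>
    (\sum_(y0 < b) \sum_(z0 < c) ent3 M x y0 z0 x' y0 z0) *
    (\sum_(x0 < a) ent3 M x0 y z x0 y' z')).

Definition marg_Y_XZ (a b c : nat) (M : 'M[C]_(a * b * c)) : 'M[C]_(a * b * c) :=
  mk3 (fun x y z x' y' z' =>
    (\sum_(x0 < a) \sum_(z0 < c) ent3 M x0 y z0 x0 y' z0) *
    (\sum_(y0 < b) ent3 M x y0 z x' y0 z')).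

Definition marg_XY_Z (a b c : nat) (M : 'M[C]_(a * b * c)) : 'M[C]_(a * b * c) :=
  mk3 (fun x y z x' y' z' =>
    (\sum_(z0 < c) ent3 M x y z0 x' y' z0) *
    (\sum_(x0 < a) \sum_(y0 < b) ent3 M x0 y0 z x0 y0 z')).

(* "D^eps_H(alpha || beta) >= log2 r", i.e. (the max being attained)
   some POVM element Pi with Tr[Pi alpha] >= 1 - eps has
   -log2 Tr[Pi beta] >= log2 r, i.e. r * Tr[Pi beta] <= 1
   (Tr[Pi beta] = 0 corresponds to D = +infinity). *)
Definition DH_ge (n : nat) (eps : C) (alpha beta : 'M[C]_n) (r : C) : Prop :=
  exists Pi : 'M[C]_n, [/\ povm_elem Pi, 1 - eps <= \tr (Pi *m alpha)
                         & r * \tr (Pi *m beta) <= 1].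

Definition cq_state (nx ny dX dY dZ : nat) (p : 'I_nx -> C) (q : 'I_ny -> C)
  (sx : 'I_nx -> 'M[C]_dX) (sy : 'I_ny -> 'M[C]_dY)
  (Phi : 'M[C]_(dX * dY) -> 'M[C]_dZ) : 'M[C]_(nx * ny * dZ) :=
  \sum_(x < nx) \sum_(y < ny)
     p x * q y *: kron (kron (delta_mx x x) (delta_mx y y)) (Phi (kron (sx x) (sy y))).

(* An (R1, R2, eta) quantum MAC code with M1 = 2^R1, M2 = 2^R2 messages. *)
Definition MAC_code (dX dY dZ M1 M2 : nat) (Phi : 'M[C]_(dX * dY) -> 'M[C]_dZ)
  (eta : C) : Prop :=
  exists (al : 'I_M1 -> 'M[C]_dX) (be : 'I_M2 -> 'M[C]_dY)
         (La : 'I_M1 -> 'I_M2 -> 'M[C]_dZ),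
    [/\ forall m1, is_state (al m1),
        forall m2, is_state (be m2),
        forall m1 m2, psd (La m1 m2),
        \sum_m1 \sum_m2 La m1 m2 = 1%:M
      & (M1 * M2)%:R^-1 *
          (\sum_m1 \sum_m2 \tr ((1%:M - La m1 m2) *m Phi (kron (al m1) (be m2))))
        <= eta].

End QDefs.

(* Main.v *)
Require Import Defs.
From HB Require Import structures.
From mathcomp Require Import all_boot all_order all_algebra.
From mathcomp Require Import spectral sesquilinear.
From mathcomp Require Import ring.
Set Implicit Arguments.
Unset Strict Implicit.
Unset Printing Implicit Defensive.
Import Order.TTheory GRing.Theory Num.Theory.
Local Open Scope ring_scope.
Local Open Scope sesquilinear_scope.

(* Let P_X, P_Y, P_0 be the three optimal tests, restricted to the diagonal
   blocks (x, y) of XYZ. They need not have a common refinement on Z, so the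
   output space is enlarged to K (x) Z, where K has an orthonormal basis |0>,
   |m1>, |m2> indexed by 0 and by the messages of the two senders. For a pair
   m = (m1, m2) the vectors
     t_X = |0> + delta |m2>,  t_Y = |0> + delta |m1>,  t_0 = |0>
   are linearly independent, with dual basis s_X, s_Y, s_0, and
     R_m = sum_i |t_i><s_i| (x) P_i
   imposes all three tests at once: <t_i| R_m^* R_m |t_i> is at most a constant
   times P_i, while the tilted output h |-> (|0> + delta |m1> + delta |m2>) (x) h
   is fixed by R_m up to a squared error of order eps and by R_m^* up to a
   squared error of order eps / delta^2. With G_m = R_m^* R_m, S = sum_m G_m and X = 2 / (1 + S),
   the operators X G_m X form a sub-POVM because 4 S <= (1 + S)^2, and its error
   is controlled by these two defects and the overlaps with the other G_m',
   without any hypothesis G_m <= 1. The tilt moves the true output by a squared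
   distance 2 delta^2, so delta^2 = 6 sqrt eps balances the errors; a random
   codebook then bounds the overlaps by eps / 2 per type of confusion. *)

(** * Positive semidefinite matrices *)

Section Psd.
Variable C : numClosedFieldType.

Lemma adjmxE m n (A : 'M[C]_(m, n)) i j : adjmx A i j = (A j i)^*.
Proof. by rewrite !mxE. Qed.

Lemma adjmxK m n : cancel (@adjmx C m n) (@adjmx C n m).
Proof. by move=> A; apply/matrixP => i j; rewrite !adjmxE conjCK. Qed.

Lemma adjmxM m n p (A : 'M[C]_(m, n)) (B : 'M[C]_(n, p)) :
  adjmx (A *m B) = adjmx B *m adjmx A.
Proof. by rewrite /adjmx map_mxM trmx_mul. Qed.

Lemma adjmxD m n (A B : 'M[C]_(m, n)) : adjmx (A + B) = adjmx A + adjmx B.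
Proof. by rewrite /adjmx map_mxD linearD. Qed.

Lemma adjmxN m n (A : 'M[C]_(m, n)) : adjmx (- A) = - adjmx A.
Proof. by rewrite /adjmx map_mxN linearN. Qed.

Lemma adjmxZ m n a (A : 'M[C]_(m, n)) : adjmx (a *: A) = a^* *: adjmx A.
Proof. by rewrite /adjmx map_mxZ linearZ. Qed.

Lemma adjmx1 n : adjmx (1%:M : 'M[C]_n) = 1%:M.
Proof. by rewrite /adjmx map_mx1 trmx1. Qed.

Definition dot n (u v : 'cV[C]_n) : C := (adjmx u *m v) 0 0.

Lemma dotE n (u v : 'cV[C]_n) : dot u v = \sum_i (u i 0)^* * v i 0.
Proof. by rewrite /dot mxE; apply: eq_bigr => i _; rewrite adjmxE. Qed.

Lemma dotDl n (u u' v : 'cV[C]_n) : dot (u + u') v = dot u v + dot u' v.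
Proof. by rewrite /dot adjmxD mulmxDl mxE. Qed.

Lemma dotDr n (u v v' : 'cV[C]_n) : dot u (v + v') = dot u v + dot u v'.
Proof. by rewrite /dot mulmxDr mxE. Qed.

Lemma dotNl n (u v : 'cV[C]_n) : dot (- u) v = - dot u v.
Proof. by rewrite /dot adjmxN mulNmx mxE. Qed.

Lemma dotNr n (u v : 'cV[C]_n) : dot u (- v) = - dot u v.
Proof. by rewrite /dot mulmxN mxE. Qed.

Lemma dotBl n (u u' v : 'cV[C]_n) : dot (u - u') v = dot u v - dot u' v.
Proof. by rewrite dotDl dotNl. Qed.

Lemma dotBr n (u v v' : 'cV[C]_n) : dot u (v - v') = dot u v - dot u v'.
Proof. by rewrite dotDr dotNr. Qed.

Lemma dotZl n a (u v : 'cV[C]_n) : dot (a *: u) v = a^* * dot u v.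
Proof. by rewrite /dot adjmxZ -scalemxAl mxE. Qed.

Lemma dotZr n a (u v : 'cV[C]_n) : dot u (a *: v) = a * dot u v.
Proof. by rewrite /dot -scalemxAr mxE. Qed.

Lemma dot0r n (u : 'cV[C]_n) : dot u 0 = 0.
Proof. by rewrite /dot mulmx0 mxE. Qed.

Lemma dot_sumr n (I : Type) (r : seq I) (P : pred I) (u : 'cV[C]_n) F :
  dot u (\sum_(i <- r | P i) F i) = \sum_(i <- r | P i) dot u (F i).
Proof. by rewrite (big_morph (dot u) (dotDr u) (dot0r u)). Qed.

Lemma dotC n (u v : 'cV[C]_n) : dot v u = (dot u v)^*.
Proof.
rewrite !dotE rmorph_sum; apply: eq_bigr => i _.
by rewrite rmorphM /= conjCK mulrC.
Qed.

Lemma dot_adjr m n (A : 'M[C]_(m, n)) u v : dot u (A *m v) = dot (adjmx A *m u) v.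
Proof. by rewrite /dot adjmxM adjmxK mulmxA. Qed.

Lemma dot_adjl m n (A : 'M[C]_(m, n)) u v : dot (A *m v) u = dot v (adjmx A *m u).
Proof. by rewrite /dot adjmxM mulmxA. Qed.

Lemma dot_ge0 n (u : 'cV[C]_n) : 0 <= dot u u.
Proof. by rewrite dotE sumr_ge0 // => i _; rewrite mulrC mul_conjC_ge0. Qed.

Lemma dot_eq0 n (u : 'cV[C]_n) : dot u u = 0 -> u = 0.
Proof.
rewrite dotE => /eqP; rewrite psumr_eq0 => [|i _]; last first.
  by rewrite mulrC mul_conjC_ge0.
move=> /allP u0; apply/matrixP => i j; rewrite ord1 mxE.
have := u0 i (mem_index_enum i).
by rewrite /= mulrC mul_conjC_eq0 => /eqP.
Qed.

Lemma psdP n (A : 'M[C]_n) : psd A <-> forall v, 0 <= dot v (A *m v).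
Proof. by split=> h v; have := h v; rewrite /dot mulmxA. Qed.

Lemma psd0 n : psd (0 : 'M[C]_n).
Proof. by apply/psdP => v; rewrite mul0mx dot0r. Qed.

Lemma psdD n (A B : 'M[C]_n) : psd A -> psd B -> psd (A + B).
Proof.
by move=> /psdP hA /psdP hB; apply/psdP => v; rewrite mulmxDl dotDr addr_ge0.
Qed.

Lemma psdZ n a (A : 'M[C]_n) : 0 <= a -> psd A -> psd (a *: A).
Proof.
by move=> a0 /psdP hA; apply/psdP => v; rewrite -scalemxAl dotZr mulr_ge0.
Qed.

Lemma psd_sum n (I : Type) (r : seq I) (P : pred I) (F : I -> 'M[C]_n) :
  (forall i, P i -> psd (F i)) -> psd (\sum_(i <- r | P i) F i).
Proof. by move=> hF; apply: big_ind => //; [apply: psd0|apply: psdD]. Qed.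

Lemma psd_congr m n (K : 'M[C]_(m, n)) A : psd A -> psd (adjmx K *m A *m K).
Proof.
move=> /psdP hA; apply/psdP => v.
by rewrite -!mulmxA dot_adjr adjmxK.
Qed.

Lemma psd_gram m n (K : 'M[C]_(m, n)) : psd (adjmx K *m K).
Proof. by apply/psdP => v; rewrite -mulmxA dot_adjr adjmxK dot_ge0. Qed.

Lemma psd1 n : psd (1%:M : 'M[C]_n).
Proof. by apply/psdP => v; rewrite mul1mx dot_ge0. Qed.

Lemma dot_delta n (M : 'M[C]_n) i j :
  dot (delta_mx i 0) (M *m delta_mx j 0) = M i j.
Proof.
rewrite -colE dotE (bigD1 i) //= big1 => [|k /negPf ki].
  by rewrite !mxE !eqxx conjC1 mul1r addr0.
by rewrite !mxE ki conjC0 mul0r.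
Qed.

(** [psd] only constrains the quadratic form, so symmetry has to be derived: since the form is real,
    that of [H := A - adjmx A] vanishes, and polarization with coefficients 1 and ['i] gives
    [H = 0]. *)
Lemma psd_herm n (A : 'M[C]_n) : psd A -> adjmx A = A.
Proof.
move=> /psdP hA; pose H := A - adjmx A.
have H0 v : dot v (H *m v) = 0.
  rewrite mulmxBl dotBr [dot v (adjmx A *m v)]dot_adjr adjmxK.
  by rewrite [dot (_ *m _) _]dotC (CrealP (ger0_real (hA v))) subrr.
have Hpol i j a : a^* * H j i + a * H i j = 0.
  have := H0 (delta_mx i 0 + a *: delta_mx j 0).
  rewrite mulmxDr !dotDl !dotDr -scalemxAr !dotZl !dotZr !dot_delta.
  have := H0 (delta_mx i 0); have := H0 (delta_mx j 0).
  by rewrite !dot_delta => -> ->; rewrite !mulr0 add0r addr0 addrC.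
apply/esym/eqP; rewrite -subr_eq0 -/H; apply/eqP/matrixP => i j; rewrite [RHS]mxE.
have := Hpol i j 1; rewrite conjC1 !mul1r => /eqP; rewrite addr_eq0 => /eqP Hij.
have := Hpol i j 'i; rewrite conjCi Hij mulrNN -mulr2n => /eqP.
by rewrite mulrn_eq0 /= mulf_eq0 (negPf (neq0Ci C)) => /eqP.
Qed.

Lemma psd_dotC n (A : 'M[C]_n) u v : psd A -> dot (A *m u) v = dot u (A *m v).
Proof. by move=> /psd_herm hA; rewrite dot_adjl hA. Qed.

(* Spectral theorem: A = P^* D P with D >= 0, so B := P^* sqrt(D). *)
Lemma psd_factor n (A : 'M[C]_n) : psd A -> exists B : 'M[C]_n, A = B *m adjmx B.
Proof.
move=> Apsd; have hA := psd_herm Apsd.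
have tE m p (M : 'M[C]_(m, p)) : M ^t* = adjmx M by rewrite /adjmx map_trmx.
have nA : A \is normalmx by apply/normalmxP; rewrite tE hA.
move/orthomx_spectralP: nA; set P := spectralmx A; set D := spectral_diag A => AE.
have uP : P *m adjmx P = 1%:M.
  by rewrite -tE; apply/unitarymxP/spectral_unitarymx.
have iP : invmx P = adjmx P.
  by rewrite -tE invmx_unitary // spectral_unitarymx.
rewrite iP in AE.
have D0 i : 0 <= D 0 i.
  have := psd_congr (adjmx P) Apsd; rewrite AE adjmxK !mulmxA uP mul1mx -mulmxA uP mulmx1.
  by move/psdP/(_ (delta_mx i 0)); rewrite dot_delta mxE eqxx.
exists (adjmx P *m diag_mx (map_mx sqrtC D)).
rewrite adjmxM adjmxK {1}AE !mulmxA; congr (_ *m _); rewrite -mulmxA; congr (_ *m _).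
apply/matrixP => i j; rewrite [RHS]mxE (bigD1 i) //= big1 => [|k /negPf ki].
  rewrite !mxE eqxx mulr1n addr0 [j == i]eq_sym; case: eqP => [->|_]; last first.
    by rewrite mulr0n conjC0 mulr0.
  by rewrite mulr1n (CrealP _) -?expr2 ?sqrtCK // ger0_real // sqrtC_ge0.
by rewrite !mxE [i == k]eq_sym ki mulr0n mul0r.
Qed.

Lemma psd_factorl n (A : 'M[C]_n) : psd A -> exists B : 'M[C]_n, A = adjmx B *m B.
Proof. by case/psd_factor => B ->; exists (adjmx B); rewrite adjmxK. Qed.

Lemma psd_trM_ge0 n (A B : 'M[C]_n) : psd A -> psd B -> 0 <= \tr (A *m B).
Proof.
move=> hA /psd_factor [K ->]; rewrite mulmxA mxtrace_mulC mulmxA.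
rewrite sumr_ge0 // => i _; rewrite -dot_delta.
exact: (psdP _).1 (psd_congr K hA) _.
Qed.

End Psd.

(** * A rational pretty good measurement *)

Section Decoder.
Variable C : numClosedFieldType.

(** Certificate for an identity modulo a known one: given [a = b], only the polynomial identity
    [c - d = a - b] is left to [ring]. *)
Lemma eq_subr (a b c d : C) : a = b -> c - d = a - b -> c = d.
Proof. by move=> -> /eqP; rewrite subrr subr_eq0 => /eqP. Qed.

(** A kernel vector v satisfies <v, v> + <v, S v> = 0 with both terms nonnegative, hence v = 0. *)
Lemma unitmx_1Dpsd n (S : 'M[C]_n) : psd S -> 1%:M + S \in unitmx.
Proof.
move=> hS; rewrite -row_free_unit -kermx_eq0; apply/eqP/row_matrixP => i.
rewrite row0; set u := row i _.
have uQ : u *m (1%:M + S) = 0 by rewrite -row_mul mulmx_ker row0.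
have Qv : adjmx u + S *m adjmx u = 0.
  have : adjmx (u *m (1%:M + S)) = 0 by rewrite uQ /adjmx map_mx0 trmx0.
  by rewrite adjmxM adjmxD adjmx1 (psd_herm hS) mulmxDl mul1mx.
have : dot (adjmx u) (adjmx u + S *m adjmx u) = 0 by rewrite Qv dot0r.
rewrite dotDr => /eqP; rewrite paddr_eq0 ?dot_ge0 //; last exact: (psdP _).1.
case/andP => /eqP /dot_eq0 u0 _.
by rewrite -[u]adjmxK u0 /adjmx map_mx0 trmx0.
Qed.

(** Parallelogram law: the gap between the two sides is the form at [u - v]. *)
Lemma dot_sqrD n (M : 'M[C]_n) u v : psd M ->
  dot (u + v) (M *m (u + v)) <= 2 * dot u (M *m u) + 2 * dot v (M *m v).
Proof.
move=> /psdP /(_ (u - v)) h; rewrite -subr_ge0; apply: le_trans h _.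
rewrite !mulmxDr !mulmxN !(dotDl, dotDr, dotNl, dotNr) le_eqVlt.
by apply/orP; left; apply/eqP; ring.
Qed.

(** Rational stand-in for the root S^(-1/2) of the pretty good measurement: the scalar functions 2 /
    (1 + s) and s^(-1/2) are tangent at s = 1, and the former lies below the latter. *)
Definition pgm_root n (S : 'M[C]_n) : 'M[C]_n := 2 *: invmx (1%:M + S).

Lemma pgm_root_herm n (S : 'M[C]_n) : psd S -> adjmx (pgm_root S) = pgm_root S.
Proof.
move=> hS; have uQ := unitmx_1Dpsd hS.
rewrite /pgm_root adjmxZ (CrealP (realn _ 2)); congr (_ *: _).
have QH : adjmx (1%:M + S) = 1%:M + S by rewrite adjmxD adjmx1 (psd_herm hS).
apply: (can_inj (mulmxK uQ)); rewrite mulVmx //.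
by rewrite -{2}QH -adjmxM mulmxV // adjmx1.
Qed.

(** From (1 + S) X v = 2 v follows S X v = 2 v - X v, and the form becomes the square |X v -
    v|^2. *)
Lemma pgm_root_le1 n (S : 'M[C]_n) : psd S ->
  psd (1%:M - pgm_root S *m S *m pgm_root S).
Proof.
move=> hS; have uQ := unitmx_1Dpsd hS; apply/psdP => v.
have XH := pgm_root_herm hS; set X := pgm_root S in XH *.
have Xv : X *m v + S *m (X *m v) = v + v.
  rewrite -{1}[X *m v]mul1mx -mulmxDl /X /pgm_root -scalemxAl -scalemxAr.
  by rewrite mulKVmx // scaler_nat mulr2n.
rewrite mulmxBl mul1mx -!mulmxA dotBr [dot v (X *m _)]dot_adjr XH.
have -> : S *m (X *m v) = v + v - X *m v by rewrite -Xv addrC addKr.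
have := dot_ge0 (X *m v - v).
rewrite !(dotDl, dotDr, dotBl, dotBr, dotNl, dotNr).
have -> : dot v (X *m v) = dot (X *m v) v by rewrite dot_adjr XH.
by congr (_ <= _); ring.
Qed.

(** The failure of the outcome [adjmx R *m R] is charged to how far [R] and [adjmx R] are from
    fixing [w], and to the mass of the competitors [T] on [w]. With y = X w - w one has (1 + S) y =
    w - S w; pairing this with [w] and [y] on either side yields all the relations needed. *)
Lemma pgm_error n (R T : 'M[C]_n) (w : 'cV[C]_n) :
  psd T ->
  dot w ((1%:M - pgm_root (adjmx R *m R + T) *m (adjmx R *m R)
                   *m pgm_root (adjmx R *m R + T)) *m w)
    <= 2 * dot (w - adjmx R *m w) (w - adjmx R *m w)
     + 2 * dot (w - R *m w) (w - R *m w) + 4 * dot w (T *m w).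
Proof.
move=> hT; set S := _ + T; set X := pgm_root S.
set e := w - R *m w; set e' := w - adjmx R *m w.
have hS : psd S by apply: psdD hT; apply: psd_gram.
have uQ := unitmx_1Dpsd hS; have XH : adjmx X = X := pgm_root_herm hS.
have [y Xw] : exists y, X *m w = w + y.
  by exists (X *m w - w); rewrite addrC subrK.
have Qy : y + S *m y = w - S *m w.
  have : X *m w + S *m (X *m w) = w + w.
    rewrite -{1}[X *m w]mul1mx -mulmxDl /X /pgm_root -scalemxAl -scalemxAr.
    by rewrite mulKVmx // scaler_nat mulr2n.
  rewrite Xw mulmxDr addrACA => /(canRL (addKr _)) ->.
  by rewrite opprD addrACA addNr add0r addrC.
have Sdot u v : dot u (S *m v) = dot (R *m u) (R *m v) + dot u (T *m v).
  by rewrite mulmxDl dotDr -mulmxA [dot u (adjmx R *m _)]dot_adjr adjmxK.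
have I1 : dot w (y + S *m y) = dot w (w - S *m w) by rewrite Qy.
have I2 : dot y (y + S *m y) = dot y (w - S *m w) by rewrite Qy.
have I3 : dot (y + S *m y) w = dot (w - S *m w) w by rewrite Qy.
have I4 : dot (y + S *m y) y = dot (w - S *m w) y by rewrite Qy.
rewrite !dotDr dotNr !Sdot in I1; rewrite !dotDr dotNr !Sdot in I2.
rewrite !dotDl dotNl !(psd_dotC _ _ hS) !Sdot in I3.
rewrite !dotDl dotNl !(psd_dotC _ _ hS) !Sdot in I4.
(* All other terms cancel in [I1 - I4 - (I3 - I2)]. *)
have wyC : dot w y = dot y w.
  apply: (mulfI (_ : 2 != 0 :> C)); first by rewrite pnatr_eq0.
  have := congr2 (fun a b => a - b) (congr2 (fun a b => a - b) I1 I4)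
                 (congr2 (fun a b => a - b) I3 I2).
  by move=> /= h; apply: (eq_subr h); ring.
rewrite mulmxBl mul1mx -!mulmxA dotBr [dot w (X *m _)]dot_adjr XH Xw.
rewrite [dot _ (adjmx R *m _)]dot_adjr adjmxK.
have Rl u v : dot u (adjmx R *m v) = dot (R *m u) v by rewrite dot_adjr adjmxK.
have Rr u v : dot (adjmx R *m v) u = dot v (R *m u) by rewrite dot_adjl adjmxK.
(* This sum of squares is the right-hand side minus the left-hand side. *)
have : 0 <= 2 * dot (y - e') (y - e') + 2 * dot (R *m y - e) (R *m y - e)
  + 2 * dot (y + w) (T *m (y + w)) + dot (y - w) (T *m (y - w))
  + dot y y + 2 * dot (R *m y) (R *m y).
  by rewrite !addr_ge0 ?mulr_ge0 ?dot_ge0 ?ler0n //; apply: (psdP _).1.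
rewrite -[in X in _ -> X]subr_ge0; congr (_ <= _).
rewrite /e /e' !mulmxDr !mulmxN.
rewrite !(dotDl, dotDr, dotNl, dotNr) !Rl !Rr.
rewrite wyC in I1 *.
(* The two sides differ by the combination [3 * I2 + I1 - 2 * I3] of the relations. *)
have := congr2 (fun a b => a - b) (congr2 (fun a b => 3 * a + b) I2 I1)
               (congr1 (fun a => 2 * a) I3).
by move=> /= h; apply: (eq_subr h); ring.
Qed.

End Decoder.

(** * Tilted tests *)

Section Tilting.
Variable C : numClosedFieldType.

Lemma addmxE m n (A B : 'M[C]_(m, n)) i j : (A + B) i j = A i j + B i j.
Proof. by rewrite mxE. Qed.

Lemma oppmxE m n (A : 'M[C]_(m, n)) i j : (- A) i j = - A i j.
Proof. by rewrite mxE. Qed.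

Lemma scalemxE m n a (A : 'M[C]_(m, n)) i j : (a *: A) i j = a * A i j.
Proof. by rewrite mxE. Qed.

Definition mxlinE := (addmxE, oppmxE, scalemxE).

Lemma adjmx0 m n : adjmx (0 : 'M[C]_(m, n)) = 0.
Proof. by rewrite /adjmx map_mx0 trmx0. Qed.

(** P - P^2 = P (1 - P) P + (1 - P) P (1 - P), a sum of two positive congruences. *)
Lemma povm_sqr_le n (P : 'M[C]_n) h :
  povm_elem P -> dot (P *m h) (P *m h) <= dot h (P *m h).
Proof.
case=> hP hQ; rewrite -subr_ge0 (psd_dotC _ _ hP).
have hQ' := (psdP _).1 hQ (P *m h); have hP' := (psdP _).1 hP (h - P *m h).
apply: le_trans (addr_ge0 hQ' hP') _; rewrite le_eqVlt; apply/orP; left; apply/eqP.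
rewrite mulmxBl mul1mx !mulmxDr !mulmxN !(dotDl, dotDr, dotNl, dotNr).
rewrite !(psd_dotC _ _ hP); ring.
Qed.

Lemma povm_elemC n (P : 'M[C]_n) : povm_elem P -> povm_elem (1%:M - P).
Proof. by case=> hP hQ; split=> //; rewrite opprB addrC subrK. Qed.

Section Tilt.
Variables (N n : nat) (J0 JA JB : 'M[C]_(N, n)) (delta : C) (PX PY P0 : 'M[C]_n).
Hypothesis (delta_gt0 : 0 < delta).

Let conj_delta : delta^* = delta.
Proof. by apply/CrealP; rewrite realE ltW. Qed.

Let conj_deltaV : (delta^-1)^* = delta^-1.
Proof. by rewrite fmorphV /= conj_delta. Qed.

Let delta_neq0 : delta != 0.
Proof. by rewrite gt_eqF. Qed.

(* The vectors t_X = |0> + delta |B>, t_Y = |0> + delta |A>, t_0 = |0> tilt the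
   three tests; the right factors are their dual basis, so the three
   conditions can be imposed simultaneously. *)
Definition tilted_test : 'M[C]_(N, N) :=
  (J0 + delta *: JB) *m PX *m adjmx (delta^-1 *: JB)
  + (J0 + delta *: JA) *m PY *m adjmx (delta^-1 *: JA)
  + J0 *m P0 *m adjmx (J0 - delta^-1 *: (JA + JB)).

Lemma tilted_testE v : tilted_test *m v =
  (J0 + delta *: JB) *m (PX *m (delta^-1 *: (adjmx JB *m v)))
  + (J0 + delta *: JA) *m (PY *m (delta^-1 *: (adjmx JA *m v)))
  + J0 *m (P0 *m (adjmx J0 *m v - delta^-1 *: (adjmx JA *m v + adjmx JB *m v))) :> 'cV_N.
Proof.
rewrite /tilted_test !mulmxDl !adjmxD adjmxN !adjmxZ adjmxD conj_deltaV.
by rewrite -!mulmxA !mulmxDl mulNmx -!scalemxAl mulmxDl.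
Qed.

Lemma tilted_testE_adj v : psd PX -> psd PY -> psd P0 ->
  adjmx tilted_test *m v =
  delta^-1 *: (JB *m (PX *m (adjmx J0 *m v + delta *: (adjmx JB *m v))))
  + delta^-1 *: (JA *m (PY *m (adjmx J0 *m v + delta *: (adjmx JA *m v))))
  + (J0 - delta^-1 *: (JA + JB)) *m (P0 *m (adjmx J0 *m v)) :> 'cV_N.
Proof.
move=> hX hY h0; rewrite /tilted_test 2![adjmx (_ + _ *m adjmx _)]adjmxD !adjmxM !adjmxK.
rewrite (psd_herm hX) (psd_herm hY) (psd_herm h0) !adjmxD !adjmxZ conj_delta.
by rewrite !mulmxDl -!mulmxA !mulmxDl -!scalemxAl.
Qed.

(** In use [al] and [be] are 0 or 1 and tell whether [v] is tilted along [JA] and along [JB]. With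
    both tilts all three tests act, [P0] with sign -1; with at most one tilt a single test
    survives. *)
Lemma tilted_test_apply v h (al be : C) :
  adjmx J0 *m v = h -> adjmx JA *m v = (al * delta) *: h ->
  adjmx JB *m v = (be * delta) *: h ->
  tilted_test *m v = be *: ((J0 + delta *: JB) *m (PX *m h))
    + al *: ((J0 + delta *: JA) *m (PY *m h))
    + (1 - al - be) *: (J0 *m (P0 *m h)) :> 'cV_N.
Proof.
move=> E0 EA EB; rewrite tilted_testE E0 EA EB !scalerA -scalerDl scalerA.
rewrite -[X in X - _]scale1r -scalerBl -!scalemxAr.
by congr (_ *: _ + _ *: _ + _ *: _); field.
Qed.

Hypothesis J0K : adjmx J0 *m J0 = 1%:M.
Hypothesis JAK : adjmx JA *m JA = 1%:M.
Hypothesis JBK : adjmx JB *m JB = 1%:M.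
Hypothesis J0A : adjmx J0 *m JA = 0.
Hypothesis J0B : adjmx J0 *m JB = 0.
Hypothesis JAB : adjmx JA *m JB = 0.

Let JA0 : adjmx JA *m J0 = 0.
Proof. by rewrite -[LHS]adjmxK adjmxM adjmxK J0A adjmx0. Qed.
Let JB0 : adjmx JB *m J0 = 0.
Proof. by rewrite -[LHS]adjmxK adjmxM adjmxK J0B adjmx0. Qed.
Let JBA : adjmx JB *m JA = 0.
Proof. by rewrite -[LHS]adjmxK adjmxM adjmxK JAB adjmx0. Qed.

(** With [J0], [JA], [JB] embedding Z as the blocks |0>, |A>, |B>, this is (|0> + delta |A> + delta
    |B>) (x) h, left unnormalized. *)
Definition tilted_vec (h : 'cV[C]_n) : 'cV[C]_N :=
  J0 *m h + delta *: (JA *m h) + delta *: (JB *m h).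

Lemma adjJ0_tilted h : adjmx J0 *m tilted_vec h = h.
Proof.
rewrite !mulmxDr -!scalemxAr !mulmxA J0K J0A J0B.
by rewrite mul1mx !mul0mx scaler0 !addr0.
Qed.

Lemma adjJA_tilted h : adjmx JA *m tilted_vec h = delta *: h.
Proof.
rewrite !mulmxDr -!scalemxAr !mulmxA JA0 JAK JAB.
by rewrite mul1mx !mul0mx scaler0 addr0 add0r.
Qed.

Lemma adjJB_tilted h : adjmx JB *m tilted_vec h = delta *: h.
Proof.
rewrite !mulmxDr -!scalemxAr !mulmxA JB0 JBA JBK.
by rewrite mul1mx !mul0mx scaler0 !add0r.
Qed.

Lemma dot_ortho u0 uA uB :
  dot (J0 *m u0 + JA *m uA + JB *m uB) (J0 *m u0 + JA *m uA + JB *m uB)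
  = dot u0 u0 + dot uA uA + dot uB uB.
Proof.
rewrite !(dotDl, dotDr) !dot_adjl !mulmxA J0K JAK JBK J0A J0B JAB JA0 JB0 JBA.
by rewrite !mul1mx !mul0mx !dot0r !addr0 !add0r.
Qed.

Hypothesis delta_le1 : delta <= 1.
Hypotheses (hX : povm_elem PX) (hY : povm_elem PY) (h0 : povm_elem P0).

Definition test_failure (h : 'cV[C]_n) : C :=
  dot h ((1%:M - PX) *m h) + dot h ((1%:M - PY) *m h) + dot h ((1%:M - P0) *m h).

Let d := delta ^+ 2.
Let d_gt0 : 0 < d. Proof. by rewrite exprn_gt0. Qed.
Let d_le1 : d <= 1. Proof. by rewrite exprn_ile1 // ltW. Qed.

(** Each test sends [h] to [h] minus a failure vector [a], [b] or [c]. The copies of [h] cancel, and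
    [povm_sqr_le] for the complementary tests bounds the squared norms of the failure vectors. *)
Lemma tilted_defect h :
  dot (tilted_vec h - tilted_test *m tilted_vec h)
      (tilted_vec h - tilted_test *m tilted_vec h) <= 4 * test_failure h.
Proof.
rewrite (@tilted_test_apply _ h 1 1) ?mul1r ?adjJ0_tilted ?adjJA_tilted ?adjJB_tilted //.
have leX := povm_sqr_le h (povm_elemC hX).
have leY := povm_sqr_le h (povm_elemC hY).
have le0 := povm_sqr_le h (povm_elemC h0).
rewrite /test_failure.
set a := (1%:M - PX) *m h in leX *; set b := (1%:M - PY) *m h in leY *.
set c := (1%:M - P0) *m h in le0 *.
have EX : PX *m h = h - a by rewrite /a mulmxBl mul1mx opprB addrC subrK.
have EY : PY *m h = h - b by rewrite /b mulmxBl mul1mx opprB addrC subrK.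
have E0 : P0 *m h = h - c by rewrite /c mulmxBl mul1mx opprB addrC subrK.
rewrite EX EY E0.
have -> : tilted_vec h - (1 *: ((J0 + delta *: JB) *m (h - a))
   + 1 *: ((J0 + delta *: JA) *m (h - b)) + (1 - 1 - 1) *: (J0 *m (h - c)))
   = J0 *m (a + b - c) + JA *m (delta *: b) + JB *m (delta *: a).
  rewrite /tilted_vec !mulmxDl !mulmxDr !mulmxN -!scalemxAl -!scalemxAr.
  by apply/matrixP => i j; rewrite !mxlinE; ring.
rewrite dot_ortho !dotZl !dotZr conj_delta.
apply: le_trans (_ : 4 * (dot a a + dot b b + dot c c) <= _); last first.
  by rewrite ler_wpM2l ?ler0n // !lerD.
rewrite -subr_ge0.
(* The three squares give |a + b - c|^2 <= 3 (|a|^2 + |b|^2 + |c|^2); the terms d |a|^2 + d |b|^2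
   fit in one more unit, hence the constant 4. *)
have : 0 <= dot (a - b) (a - b) + dot (a + c) (a + c) + dot (b + c) (b + c)
   + dot c c + (1 - d) * (dot a a + dot b b).
  by rewrite !addr_ge0 ?mulr_ge0 ?subr_ge0 ?addr_ge0 ?dot_ge0.
congr (_ <= _); rewrite !(dotDl, dotDr, dotNl, dotNr) /d; ring.
Qed.

(** The adjoint outputs the dual vectors, whose length is of order 1 / delta; this costs the factor
    1 / d. *)
Lemma tilted_defect_adj h :
  dot (tilted_vec h - adjmx tilted_test *m tilted_vec h)
      (tilted_vec h - adjmx tilted_test *m tilted_vec h) <= 8 / d * test_failure h.
Proof.
have [[pX _] [pY _] [p0 _]] := And3 hX hY h0.
rewrite tilted_testE_adj // adjJ0_tilted adjJA_tilted adjJB_tilted.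
have leX := povm_sqr_le h (povm_elemC hX).
have leY := povm_sqr_le h (povm_elemC hY).
have le0 := povm_sqr_le h (povm_elemC h0).
rewrite /test_failure.
have -> : h + delta *: (delta *: h) = (1 + d) *: h.
  by rewrite scalerA -expr2 scalerDl scale1r.
rewrite -!scalemxAr.
set a := (1%:M - PX) *m h in leX *; set b := (1%:M - PY) *m h in leY *.
set c := (1%:M - P0) *m h in le0 *.
have EX : PX *m h = h - a by rewrite /a mulmxBl mul1mx opprB addrC subrK.
have EY : PY *m h = h - b by rewrite /b mulmxBl mul1mx opprB addrC subrK.
have E0 : P0 *m h = h - c by rewrite /c mulmxBl mul1mx opprB addrC subrK.
rewrite EX EY E0.
set r := tilted_vec h - _.
have -> : r = J0 *m c + JA *m (delta^-1 *: ((1 + d) *: b - c))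
                + JB *m (delta^-1 *: ((1 + d) *: a - c)).
  rewrite /r /tilted_vec !mulmxBl -!scalemxAl -!scalemxAr !mulmxDl.
  rewrite !(mulmxDr, mulmxN) -!scalemxAr.
  by apply/matrixP => i j; rewrite !mxlinE /d; field.
rewrite dot_ortho !dotZl !dotZr conj_deltaV.
apply: le_trans (_ : 8 / d * (dot a a + dot b b + dot c c) <= _); last first.
  by rewrite ler_wpM2l ?divr_ge0 ?ler0n ?(ltW d_gt0) // !lerD.
rewrite -subr_ge0.
(* By |(1 + d) a - c|^2 <= 2 (1 + d)^2 |a|^2 + 2 |c|^2 and its analogue for [b], the slack below 8
   is 8 - 2 (1 + d)^2 = 2 (1 - d) (3 + d) for [a] and [b], and 8 - (4 + d) = 3 + (1 - d) for [c]. *)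
have : 0 <= d^-1 * (dot ((1 + d) *: a + c) ((1 + d) *: a + c)
   + dot ((1 + d) *: b + c) ((1 + d) *: b + c)
   + 2 * (1 - d) * (3 + d) * (dot a a + dot b b) + (3 + (1 - d)) * dot c c).
  have d0 := ltW d_gt0; have d1 : 0 <= 1 - d by rewrite subr_ge0.
  have d3 : 0 <= 3 + (1 - d) by rewrite addr_ge0 ?ler0n.
  have d4 : 0 <= 2 * (1 - d) * (3 + d) by rewrite !(ler0n, d0, d1, addr_ge0, mulr_ge0).
  by rewrite !(dot_ge0, invr_ge0, d0, d3, d4, addr_ge0, mulr_ge0).
have conj_d : (1 + d)^* = 1 + d.
  by rewrite rmorphD rmorph1 /d rmorphXn /= conj_delta.
congr (_ <= _); rewrite !(dotDl, dotDr, dotNl, dotNr, dotZl, dotZr) conj_d /d; field.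
exact: delta_neq0.
Qed.

End Tilt.
End Tilting.

(** * Packing *)

(** The three sums are the three ways to confuse a pair: wrong first message, wrong second message,
    both wrong. *)
Lemma sum_pairD1 (V : nmodType) (I1 I2 : finType) (m : I1 * I2) (F : I1 * I2 -> V) :
  \sum_(q | q != m) F q =
  \sum_(i | i != m.1) F (i, m.2) + \sum_(j | j != m.2) F (m.1, j)
  + \sum_(i | i != m.1) \sum_(j | j != m.2) F (i, j).
Proof.
case: m => m1 m2 /=.
have -> : \sum_(q | q != (m1, m2)) F q
    = \sum_i \sum_(j | (i != m1) || (j != m2)) F (i, j).
  rewrite pair_big_dep /=; apply: eq_big => [[i j]|[i j] _] //=.
  by rewrite xpair_eqE negb_and.
rewrite (bigD1 m1) //= eqxx /= addrAC [LHS]addrC; congr (_ + _).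
rewrite -big_split; apply: eq_bigr => i /negPf im /=; rewrite im /=.
by rewrite (bigD1 m2).
Qed.

Section Packing.
Variable C : numClosedFieldType.

(** The isometry h -> |a> (x) h; enumerating the pairs lets the label set be any finite type. *)
Definition block (L : finType) n (a : L) : 'M[C]_(#|{: L * 'I_n}|, n) :=
  \matrix_(r, z) (enum_val r == (a, z))%:R.

Lemma block_ortho (L : finType) n (a b : L) :
  adjmx (@block L n a) *m block n b = (a == b)%:R%:M.
Proof.
apply/matrixP => z z'; rewrite !mxE.
under eq_bigr do rewrite adjmxE !mxE conjC_nat.
rewrite (bigD1 (enum_rank (a, z))) //= big1 => [|r rE]; last first.
  case: eqP => [E|_]; last by rewrite mul0r.
  by rewrite -E enum_valK eqxx in rE.
rewrite addr0 enum_rankK eqxx mul1r xpair_eqE.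
by case: (a == b); rewrite ?mul0rn //; case: eqP.
Qed.

Variables (n : nat) (I1 I2 : finType) (PX PY P0 : I1 -> I2 -> 'M[C]_n) (d : C).
Hypotheses (hX : forall i j, povm_elem (PX i j))
  (hY : forall i j, povm_elem (PY i j)) (h0 : forall i j, povm_elem (P0 i j)).
Hypotheses (d_gt0 : 0 < d) (d_le1 : d <= 1).

(** Analogue for three tests of the Hayashi-Nagaoka bound: failures of the own tests, price of the
    tilt, false acceptances. [PX] guards against a wrong first message, [PY] against a wrong second
    one, [P0] against both. The constants are twice 24 / d, 2 d and 8, because [dot_sqrD] is used to
    pass from the tilted to the untilted vector. *)
Definition packing_bound (m1 : I1) (m2 : I2) : 'M[C]_n :=
  (48 / d) *: ((1%:M - PX m1 m2) + (1%:M - PY m1 m2) + (1%:M - P0 m1 m2))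
  + (4 * d) *: 1%:M
  + 16 *: (\sum_(i | i != m1) PX i m2 + \sum_(j | j != m2) PY m1 j
           + \sum_(i | i != m1) \sum_(j | j != m2) P0 i j).

Let delta := sqrtC d.
Let delta_gt0 : 0 < delta. Proof. by rewrite sqrtC_gt0. Qed.
Let deltaE : delta ^+ 2 = d. Proof. exact: sqrtCK. Qed.
Let delta_le1 : delta <= 1.
Proof. by rewrite -(sqrtC1 C) ler_sqrtC ?nnegrE ?ler01 ?(ltW d_gt0). Qed.

(* Label None carries the untilted copy of Z; every message of either sender
   tilts in its own orthogonal direction, so that a test for another message
   does not see the tilt at all. *)
Let L := option (I1 + I2).
Let J0 := block n (None : L).
Let JA (i : I1) := block n (Some (inl i) : L).
Let JB (j : I2) := block n (Some (inr j) : L).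
Let R (q : I1 * I2) :=
  tilted_test J0 (JA q.1) (JB q.2) delta (PX q.1 q.2) (PY q.1 q.2) (P0 q.1 q.2).
Let G q := adjmx (R q) *m R q.
Let S := \sum_q G q.
Let Lam q := pgm_root S *m G q *m pgm_root S.
Let w (q : I1 * I2) := tilted_vec J0 (JA q.1) (JB q.2) delta.

Let psdG q : psd (G q). Proof. exact: psd_gram. Qed.
Let psdS : psd S. Proof. by apply: psd_sum. Qed.
Let psdLam q : psd (Lam q).
Proof. by have := psd_congr (pgm_root S) (psdG q); rewrite pgm_root_herm. Qed.

Let J0K : adjmx J0 *m J0 = 1%:M. Proof. by rewrite block_ortho eqxx. Qed.
Let JAK i : adjmx (JA i) *m JA i = 1%:M. Proof. by rewrite block_ortho eqxx. Qed.
Let JBK j : adjmx (JB j) *m JB j = 1%:M. Proof. by rewrite block_ortho eqxx. Qed.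
Let J0A i : adjmx J0 *m JA i = 0. Proof. by rewrite block_ortho /= raddf0. Qed.
Let J0B j : adjmx J0 *m JB j = 0. Proof. by rewrite block_ortho /= raddf0. Qed.
Let JAB i j : adjmx (JA i) *m JB j = 0.
Proof. by rewrite block_ortho /= raddf0. Qed.

Let adj_block_tilted (b : L) m h : adjmx (block n b) *m w m h =
  ((b == None)%:R + (b == Some (inl m.1))%:R * delta
   + (b == Some (inr m.2))%:R * delta) *: h.
Proof.
rewrite /w /tilted_vec !mulmxDr -!scalemxAr !mulmxA !block_ortho !mul_scalar_mx.
by rewrite !scalerA -!scalerDl ![delta * _]mulrC.
Qed.

Let dot_tilt1 i j u :
  dot ((J0 + delta *: JB j) *m u) ((J0 + delta *: JB j) *m u) <= 2 * dot u u /\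
  dot ((J0 + delta *: JA i) *m u) ((J0 + delta *: JA i) *m u) <= 2 * dot u u.
Proof.
have cd : delta^* = delta by apply/CrealP; rewrite realE ltW.
have le : dot u u + d * dot u u <= 2 * dot u u.
  by rewrite -[X in X + _]mul1r -mulrDl ler_wpM2r ?dot_ge0 // -[2]/(1 + 1) lerD2l.
have D := dot_ortho (J0K) (JAK i) (JBK j) (J0A i) (J0B j) (JAB i j) u.
split; apply: le_trans le; rewrite mulmxDl -scalemxAl scalemxAr le_eqVlt; apply/orP; left.
  have := D 0 (delta *: u).
  rewrite mulmx0 addr0 => ->; rewrite dot0r addr0 dotZl dotZr cd mulrA -expr2 deltaE.
  exact: eqxx.
have := D (delta *: u) 0.
rewrite mulmx0 addr0 => ->; rewrite dot0r addr0 dotZl dotZr cd mulrA -expr2 deltaE.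
exact: eqxx.
Qed.

(** The dual vectors of [q] detect the tilt of [m] only where the labels agree, so [R q] acts on
    [w m h] through exactly one of its tests. The factor 2 bounds 1 + d, the squared length of t_X
    and t_Y. *)
Lemma tilted_test_mismatch (m q : I1 * I2) h : q != m ->
  dot (w m h) (G q *m w m h) <= 2 *
    (if q.2 == m.2 then dot h (PX q.1 q.2 *m h)
     else if q.1 == m.1 then dot h (PY q.1 q.2 *m h)
     else dot h (P0 q.1 q.2 *m h)).
Proof.
move=> qm; rewrite /G -mulmxA dot_adjr adjmxK.
rewrite (@tilted_test_apply _ _ _ _ _ _ _ _ _ _ delta_gt0 _ h
           (q.1 == m.1)%:R (q.2 == m.2)%:R);
  first last.
- by rewrite /JB adj_block_tilted !eqE /= !eqE /= mul0r !add0r.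
- by rewrite /JA adj_block_tilted !eqE /= !eqE /= mul0r add0r addr0.
- by rewrite /J0 adj_block_tilted eqxx !mul0r !addr0 scale1r.
have tX u := (dot_tilt1 q.1 q.2 u).1; have tY u := (dot_tilt1 q.1 q.2 u).2.
case: eqP => [q2|_] /=.
  have -> : (q.1 == m.1) = false.
    by apply: contraNF qm => /eqP q1; case: (q) (m) q1 q2 => ? ? [? ?] /= -> ->.
  rewrite subr0 subrr !scale0r scale1r !addr0; apply: le_trans (tX _) _.
  by rewrite ler_wpM2l ?ler0n // povm_sqr_le.
case: eqP => [q1|_] /=.
  rewrite subrr subr0 !scale0r scale1r !addr0 add0r; apply: le_trans (tY _) _.
  by rewrite ler_wpM2l ?ler0n // povm_sqr_le.
rewrite !subr0 !scale0r scale1r !add0r dot_adjl [adjmx J0 *m _]mulmxA J0K mul1mx.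
have le := povm_sqr_le h (h0 q.1 q.2).
apply: le_trans le _; rewrite -[X in X <= _]mul1r ler_wpM2r ?ler1n //.
exact: (psdP _).1 (h0 q.1 q.2).1 h.
Qed.

(** The two defects add up to 2 * 8 / d + 2 * 4 = 8 (2 + d) / d, at most 24 / d since d <= 1; every
    mismatch enters with 4 * 2 = 8. *)
Lemma tilted_pgm_error m h :
  dot (w m h) ((1%:M - Lam m) *m w m h) <=
  24 / d * test_failure (PX m.1 m.2) (PY m.1 m.2) (P0 m.1 m.2) h
  + 8 * dot h ((\sum_(i | i != m.1) PX i m.2 + \sum_(j | j != m.2) PY m.1 j
           + \sum_(i | i != m.1) \sum_(j | j != m.2) P0 i j) *m h).
Proof.
pose T := \sum_(q | q != m) G q.
have hT : psd T by apply: psd_sum.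
have SE : S = adjmx (R m) *m R m + T by rewrite /S (bigD1 m).
have := pgm_error (R m) (w m h) hT; rewrite -SE => /le_trans; apply.
have dT : 4 * dot (w m h) (T *m w m h) <= 8 * dot h
   ((\sum_(i | i != m.1) PX i m.2 + \sum_(j | j != m.2) PY m.1 j
           + \sum_(i | i != m.1) \sum_(j | j != m.2) P0 i j) *m h).
  rewrite -[8]/(4 * 2)%:R natrM -mulrA ler_wpM2l ?ler0n // mulmx_suml dot_sumr.
  apply: (@le_trans _ _ (\sum_(q | q != m) 2 *
    (if q.2 == m.2 then dot h (PX q.1 q.2 *m h)
     else if q.1 == m.1 then dot h (PY q.1 q.2 *m h)
     else dot h (P0 q.1 q.2 *m h)))).
    by apply: ler_sum => q; apply: tilted_test_mismatch.
  rewrite -mulr_sumr ler_wpM2l ?ler0n // sum_pairD1 /=.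
  rewrite !mulmxDl !dotDr !mulmx_suml !dot_sumr le_eqVlt; apply/orP; left; apply/eqP.
  congr (_ + _ + _); apply: eq_bigr => i /negPf im; rewrite ?eqxx ?im //.
  rewrite mulmx_suml dot_sumr; apply: eq_bigr => j /negPf jm.
  by rewrite jm.
apply: lerD dT.
have Ea := tilted_defect_adj delta_gt0 J0K (JAK m.1) (JBK m.2) (J0A m.1) (J0B m.2)
  (JAB m.1 m.2) delta_le1 (hX m.1 m.2) (hY m.1 m.2) (h0 m.1 m.2) h.
have E := tilted_defect delta_gt0 J0K (JAK m.1) (JBK m.2) (J0A m.1) (J0B m.2)
  (JAB m.1 m.2) delta_le1 (hX m.1 m.2) (hY m.1 m.2) (h0 m.1 m.2) h.
rewrite deltaE in Ea; set t := test_failure _ _ _ _ in Ea E *.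
have t0 : 0 <= t.
  by rewrite !addr_ge0 //; apply: (psdP _).1;
     [case: (hX m.1 m.2)|case: (hY m.1 m.2)|case: (h0 m.1 m.2)].
apply: le_trans (_ : 2 * (8 / d * t) + 2 * (4 * t) <= _).
  by apply: lerD; rewrite ler_wpM2l ?ler0n.
have -> : 2 * (8 / d * t) + 2 * (4 * t) = (8 * (2 + d) / d) * t.
  by field; rewrite gt_eqF.
rewrite ler_wpM2r // ler_wpM2r ?invr_ge0 ?(ltW d_gt0) //.
by rewrite -[24]/(8 * (2 + 1))%:R natrM natrD ler_wpM2l ?ler0n // lerD2l.
Qed.

(** The measurement on K (x) Z is compressed to the block |0>: Z is measured together with an
    ancilla prepared in |0>. As the error estimate concerns tilted vectors, the input [J0 *m h] is
    split into [w m h] and a multiple of the tilt direction [g]. *)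
Lemma packing : exists La : I1 -> I2 -> 'M[C]_n,
  [/\ forall m1 m2, psd (La m1 m2), psd (1%:M - \sum_i \sum_j La i j)
    & forall m1 m2, psd (packing_bound m1 m2 - (1%:M - La m1 m2))].
Proof.
exists (fun i j => adjmx J0 *m Lam (i, j) *m J0); split=> [i j||m1 m2].
- exact: psd_congr.
- have -> : 1%:M - \sum_i \sum_j adjmx J0 *m Lam (i, j) *m J0
      = adjmx J0 *m (1%:M - pgm_root S *m S *m pgm_root S) *m J0.
    rewrite mulmxBr mulmx1 mulmxBl J0K pair_bigA /=; congr (_ - _).
    rewrite [in RHS]mulmx_sumr mulmx_suml mulmx_sumr mulmx_suml.
    by apply: eq_bigr => -[].
  by apply: psd_congr; apply: pgm_root_le1.
apply/psdP => h; set m := (m1, m2).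
have psdL : psd (1%:M - Lam m).
  have -> : 1%:M - Lam m = (1%:M - pgm_root S *m S *m pgm_root S)
       + \sum_(q | q != m) Lam q.
    rewrite {2}/S mulmx_sumr mulmx_suml (bigD1 m) //=.
    by rewrite opprD addrA subrK.
  by apply: psdD; [apply: pgm_root_le1|apply: psd_sum].
have cd : delta^* = delta by apply/CrealP; rewrite realE ltW.
pose g := JA m1 *m h + JB m2 *m h.
have E : J0 *m h = w m h + (- delta *: g).
  by rewrite /w /tilted_vec /g scaleNr scalerDr -[J0 *m h + _ + _]addrA addrK.
have gg : dot g g = 2 * dot h h.
  have := dot_ortho J0K (JAK m1) (JBK m2) (J0A m1) (J0B m2) (JAB m1 m2) 0 h h.
  by rewrite mulmx0 add0r -/g => ->; rewrite dot0r add0r mulr_natl mulr2n.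
(* Bounding 1 - Lam m by 1 makes the tilt cost 2 * d * (2 |h|^2), the [4 * d] term of the bound. *)
have gL : dot g ((1%:M - Lam m) *m g) <= 2 * dot h h.
  by rewrite -gg mulmxBl mul1mx dotBr gerBl; apply: (psdP _).1.
have -> : 1%:M - adjmx J0 *m Lam (m1, m2) *m J0 = adjmx J0 *m (1%:M - Lam m) *m J0.
  by rewrite mulmxBr mulmx1 mulmxBl J0K.
rewrite mulmxBl dotBr subr_ge0 -!mulmxA dot_adjr adjmxK E.
apply: le_trans (dot_sqrD _ _ psdL) _.
have := tilted_pgm_error m h; rewrite /= -/m => err.
rewrite -scalemxAr dotZl dotZr rmorphN /= cd.
rewrite [- delta * (- delta * _)]mulrA mulrNN -expr2 deltaE.
set Sg := (X in _ <= _ + 8 * dot h (X *m h)) in err.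
set t := test_failure _ _ _ _ in err.
have -> : dot h (packing_bound m1 m2 *m h)
    = 48 / d * t + 4 * d * dot h h + 16 * dot h (Sg *m h).
  have D (A B : 'M[C]_n) : dot h ((A + B) *m h) = dot h (A *m h) + dot h (B *m h).
    by rewrite mulmxDl dotDr.
  have Z a (A : 'M[C]_n) : dot h ((a *: A) *m h) = a * dot h (A *m h).
    by rewrite -scalemxAl dotZr.
  by rewrite /packing_bound -/Sg 2!D !Z mul1mx /t /test_failure -!D.
have -> : 48 / d * t + 4 * d * dot h h + 16 * dot h (Sg *m h)
    = 2 * (24 / d * t + 8 * dot h (Sg *m h)) + 2 * (d * (2 * dot h h)).
  by field; rewrite gt_eqF.
by apply: lerD; rewrite ler_wpM2l ?ler0n // ler_wpM2l // ltW.
Qed.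

End Packing.

(** * Channels and block-diagonal states *)

Lemma mxvec_indexK m n (i : 'I_m) (j : 'I_n) : unidx (mxvec_index i j) = (i, j).
Proof. by rewrite /unidx /mxvec_index cast_ordK enum_rankK. Qed.

Lemma sum_mxvec_index (V : nmodType) m n (F : 'I_(m * n) -> V) :
  \sum_k F k = \sum_i \sum_j F (mxvec_index i j).
Proof.
rewrite pair_bigA (reindex _ (curry_mxvec_bij _ _)) /=.
by apply: eq_bigr => -[].
Qed.

Section Channel.
Variable C : numClosedFieldType.

(** Selection along [f] is congruence by the 0/1 matrix of [f], which need not be injective. *)
Lemma psd_mxsub m n (f : 'I_m -> 'I_n) (A : 'M[C]_n) : psd A -> psd (mxsub f f A).
Proof.
pose K : 'M[C]_(n, m) := \matrix_(k, j) (k == f j)%:R.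
suff -> : mxsub f f A = adjmx K *m A *m K by apply: psd_congr.
apply/matrixP => i j; rewrite [LHS]mxE -mulmxA mxE (bigD1 (f i)) //= big1 => [|k kf].
  rewrite !mxE (bigD1 (f j)) //= big1 => [|k kf].
    by rewrite !mxE !eqxx conjC1 mul1r mulr1 !addr0.
  by rewrite [X in _ * X]mxE (negPf kf) mulr0.
by rewrite adjmxE mxE (negPf kf) conjC0 mul0r.
Qed.

Lemma kron_mul m n (A B : 'M[C]_m) (A' B' : 'M[C]_n) :
  kron A A' *m kron B B' = kron (A *m B) (A' *m B').
Proof.
apply/matrixP => i j; rewrite !mxE sum_mxvec_index big_distrlr /=.
apply: eq_bigr => k _; apply: eq_bigr => l _.
by rewrite !mxE mxvec_indexK /=; ring.
Qed.

Lemma psd_kron m n (A : 'M[C]_m) (B : 'M[C]_n) : psd A -> psd B -> psd (kron A B).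
Proof.
move=> /psd_factorl [K ->] /psd_factorl [K' ->]; rewrite -kron_mul.
suff -> : kron (adjmx K) (adjmx K') = adjmx (kron K K') by apply: psd_gram.
by apply/matrixP => i j; rewrite !mxE rmorphM.
Qed.

Lemma tr_kron m n (A : 'M[C]_m) (B : 'M[C]_n) : \tr (kron A B) = \tr A * \tr B.
Proof.
rewrite /mxtrace sum_mxvec_index big_distrlr /=.
by apply: eq_bigr => i _; apply: eq_bigr => j _; rewrite mxE mxvec_indexK.
Qed.

Lemma state_kron m n (A : 'M[C]_m) (B : 'M[C]_n) :
  is_state A -> is_state B -> is_state (kron A B).
Proof.
by move=> [pA tA] [pB tB]; split; [apply: psd_kron|rewrite tr_kron tA tB mulr1].
Qed.

(** Positivity of [Phi] is complete positivity at k = 1, up to relabelling: ['I_(1 * n)] and ['I_n]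
    are different index types. *)
Lemma state_channel n m (Phi : 'M[C]_n -> 'M[C]_m) (A : 'M[C]_n) :
  is_channel Phi -> is_state A -> is_state (Phi A).
Proof.
case=> _ cp tp [pA tA]; split; last by rewrite tp.
pose snd p (r : 'I_(1 * p)) := (unidx r).2.
have := cp 1%N _ (psd_mxsub (@snd n) pA).
set M := ampl _ _ => pM.
suff -> : Phi A = mxsub (mxvec_index ord0) (mxvec_index ord0) M.
  exact: psd_mxsub.
apply/matrixP => i j; rewrite mxE mxE !mxvec_indexK /=; congr (Phi _ _ _).
by apply/matrixP => a b; rewrite !mxE /snd !mxvec_indexK.
Qed.

End Channel.

Section CQ.
Variable C : numClosedFieldType.

Lemma ent3_mk3 a b c (F : 'I_a -> 'I_b -> 'I_c -> 'I_a -> 'I_b -> 'I_c -> C)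
  x y z x' y' z' : ent3 (mk3 F) x y z x' y' z' = F x y z x' y' z'.
Proof. by rewrite /ent3 /idx3 mxE !mxvec_indexK. Qed.

Definition blockdiag a b c (M : 'M[C]_(a * b * c)) (B : 'I_a -> 'I_b -> 'M[C]_c) :=
  forall x y z x' y' z',
    ent3 M x y z x' y' z' = (x == x')%:R * (y == y')%:R * B x y z z'.

Definition diag_block a b c (M : 'M[C]_(a * b * c)) x y : 'M[C]_c :=
  mxsub (@idx3 a b c x y) (@idx3 a b c x y) M.

Lemma povm_diag_block a b c (P : 'M[C]_(a * b * c)) x y :
  povm_elem P -> povm_elem (diag_block P x y).
Proof.
case=> hP hQ; split; first exact: psd_mxsub.
suff -> : 1%:M - diag_block P x y = diag_block (1%:M - P) x y by apply: psd_mxsub.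
apply/matrixP => i j; rewrite !mxE; congr (_%:R - _).
by rewrite (can_eq (g := fun r => (unidx r).2)) // => z; rewrite mxvec_indexK.
Qed.

Lemma sum_eqr (I : finType) (F : I -> C) i : \sum_j (i == j)%:R * F j = F i.
Proof.
rewrite (bigD1 i) //= big1 => [|j /negPf ij]; first by rewrite eqxx mul1r addr0.
by rewrite eq_sym ij mul0r.
Qed.

(** Off-diagonal blocks of [P] only meet zero blocks of [M], so a test on XYZ acts through its
    diagonal blocks. *)
Lemma tr_blockdiag a b c (P M : 'M[C]_(a * b * c)) B : blockdiag M B ->
  \tr (P *m M) = \sum_x \sum_y \tr (diag_block P x y *m B x y).
Proof.
move=> hM; rewrite /mxtrace !sum_mxvec_index; apply: eq_bigr => x _.
apply: eq_bigr => y _; apply: eq_bigr => z _; rewrite !mxE !sum_mxvec_index.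
transitivity (\sum_x' (x == x')%:R * (\sum_y' (y == y')%:R *
    (\sum_z' P (idx3 x y z) (idx3 x' y' z') * B x' y' z' z))).
  apply: eq_bigr => x' _; rewrite mulr_sumr; apply: eq_bigr => y' _.
  rewrite !mulr_sumr; apply: eq_bigr => z' _.
  rewrite -/(idx3 x y z) -/(idx3 x' y' z') -[M _ _]/(ent3 M x' y' z' x y z) hM.
  by rewrite [x' == x]eq_sym [y' == y]eq_sym; ring.
by rewrite !sum_eqr; apply: eq_bigr => z' _; rewrite mxE.
Qed.

Section State.
Variables (nx ny n : nat) (p : 'I_nx -> C) (q : 'I_ny -> C).
Variable rho : 'I_nx -> 'I_ny -> 'M[C]_n.
Hypotheses (hp : is_distr p) (hq : is_distr q).
Hypothesis tr_rho : forall x y, \tr (rho x y) = 1.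

Let sigma : 'M[C]_(nx * ny * n) := \sum_x \sum_y
  p x * q y *: kron (kron (delta_mx x x) (delta_mx y y)) (rho x y).

Lemma blockdiag_cq : blockdiag sigma (fun x y => (p x * q y) *: rho x y).
Proof.
move=> x y z x' y' z'; rewrite /ent3 /sigma summxE.
transitivity (\sum_x0 (x == x0)%:R * (\sum_y0 (y == y0)%:R *
    ((x' == x0)%:R * (y' == y0)%:R * (p x0 * q y0 * rho x0 y0 z z')))).
  apply: eq_bigr => x0 _; rewrite summxE mulr_sumr; apply: eq_bigr => y0 _.
  rewrite mxE mxE /idx3 !mxvec_indexK /= mxE !mxvec_indexK /= !mxE -!mulnb !natrM.
  by ring.
by rewrite !sum_eqr mxE [x' == x]eq_sym [y' == y]eq_sym.
Qed.

Lemma margX_cq x x' : \sum_y0 \sum_z0 ent3 sigma x y0 z0 x' y0 z0 = (x == x')%:R * p x.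
Proof.
under eq_bigr => y0 _.
  under eq_bigr => z0 _ do rewrite blockdiag_cq mxE eqxx mulr1.
  rewrite -!mulr_sumr -/(\tr _) tr_rho mulr1.
  over.
by rewrite -!mulr_sumr hq.2 mulr1.
Qed.

Lemma margY_cq y y' : \sum_x0 \sum_z0 ent3 sigma x0 y z0 x0 y' z0 = (y == y')%:R * q y.
Proof.
under eq_bigr => x0 _.
  under eq_bigr => z0 _ do rewrite blockdiag_cq mxE eqxx mul1r.
  rewrite -!mulr_sumr -/(\tr _) tr_rho mulr1 mulrCA.
  over.
by rewrite -mulr_suml hp.2 mul1r.
Qed.

Lemma margXY_cq x y x' y' :
  \sum_z0 ent3 sigma x y z0 x' y' z0 = (x == x')%:R * (y == y')%:R * (p x * q y).
Proof.
under eq_bigr => z0 _ do rewrite blockdiag_cq mxE.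
by rewrite -!mulr_sumr -/(\tr _) tr_rho mulr1.
Qed.

Lemma blockdiag_X_YZ : blockdiag (marg_X_YZ sigma)
  (fun x y => (p x * q y) *: \sum_x0 p x0 *: rho x0 y).
Proof.
move=> x y z x' y' z'; rewrite /marg_X_YZ ent3_mk3 margX_cq.
under eq_bigr => x0 _ do rewrite blockdiag_cq mxE eqxx mul1r.
rewrite mxE summxE !mulr_sumr; apply: eq_bigr => x0 _; rewrite mxE; ring.
Qed.

Lemma blockdiag_Y_XZ : blockdiag (marg_Y_XZ sigma)
  (fun x y => (p x * q y) *: \sum_y0 q y0 *: rho x y0).
Proof.
move=> x y z x' y' z'; rewrite /marg_Y_XZ ent3_mk3 margY_cq.
under eq_bigr => y0 _ do rewrite blockdiag_cq mxE eqxx mulr1.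
rewrite mxE summxE !mulr_sumr; apply: eq_bigr => y0 _; rewrite mxE; ring.
Qed.

Lemma blockdiag_XY_Z : blockdiag (marg_XY_Z sigma)
  (fun x y => (p x * q y) *: \sum_x0 \sum_y0 (p x0 * q y0) *: rho x0 y0).
Proof.
move=> x y z x' y' z'; rewrite /marg_XY_Z ent3_mk3 margXY_cq.
under eq_bigr => x0 _ do under eq_bigr => y0 _ do rewrite blockdiag_cq !eqxx !mul1r.
rewrite mxE summxE -mulrA; congr (_ * (_ * _)).
by apply: eq_bigr => x0 _; rewrite summxE.
Qed.

(** [sigma] and [beta] share the block weights [p x * q y], so a single test on XYZ becomes a family
    of tests on Z with averaged error bounds. *)
Lemma DH_diag_blocks eps beta r B : blockdiag beta (fun x y => (p x * q y) *: B x y) ->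
  DH_ge eps sigma beta r ->
  exists P : 'I_nx -> 'I_ny -> 'M[C]_n, [/\ forall x y, povm_elem (P x y),
     \sum_x \sum_y p x * q y * \tr ((1%:M - P x y) *m rho x y) <= eps
   & r * \sum_x \sum_y p x * q y * \tr (P x y *m B x y) <= 1].
Proof.
move=> hbeta [P [povmP Pa Pb]]; exists (diag_block P); split.
- by move=> x y; apply: povm_diag_block.
- rewrite (tr_blockdiag _ blockdiag_cq) in Pa.
  rewrite lerBlDr -lerBlDl in Pa; apply: le_trans Pa.
  have pq1 : \sum_x \sum_y p x * q y = 1.
    by rewrite -big_distrlr /= hp.2 hq.2 mulr1.
  rewrite -[X in _ <= X - _]pq1 -sumrB le_eqVlt.
  apply/orP; left; apply/eqP; apply: eq_bigr => x _.
  rewrite -sumrB; apply: eq_bigr => y _.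
  by rewrite mulmxBl mul1mx linearB /= tr_rho mulrBr mulr1 -scalemxAr mxtraceZ.
- move: Pb; rewrite (tr_blockdiag _ hbeta).
  under eq_bigr => x _ do under eq_bigr => y _ do rewrite -scalemxAr mxtraceZ.
  by [].
Qed.

End State.
End CQ.

(** * Random codebooks *)

Section Expectation.
Variable C : numClosedFieldType.

(** The order on [C] is partial; realness turns the failure of [B i <= K] into [K < B i]. If that
    held for all i, every weight would vanish, against total mass 1. *)
Lemma exists_le_mean (I : finType) (w B : I -> C) (K : C) :
  (forall i, 0 <= w i) -> \sum_i w i = 1 -> (forall i, B i \is Num.real) ->
  K \is Num.real -> \sum_i w i * B i <= K -> exists i, B i <= K.
Proof.
move=> w0 w1 Br Kr le; apply/existsP; rewrite -[[exists _, _]]negbK negb_exists.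
apply/negP => /forallP hB.
have Bi i : K < B i by rewrite real_ltNge.
have : \sum_i w i * (B i - K) <= 0.
  under eq_bigr do rewrite mulrBr.
  by rewrite sumrB -mulr_suml w1 mul1r subr_le0.
have t0 i : true -> 0 <= w i * (B i - K) by rewrite mulr_ge0 // subr_ge0 ltW.
move=> le0; have : \sum_i w i * (B i - K) == 0 by rewrite eq_le le0 sumr_ge0.
rewrite psumr_eq0 // => /allP h.
have : \sum_i w i = 0.
  apply: big1 => i _; have /eqP := h i (mem_index_enum i).
  by move/eqP; rewrite mulf_eq0 subr_eq0 (gt_eqF (Bi i)) orbF => /eqP.
by rewrite w1 => /eqP; rewrite oner_eq0.
Qed.

Section Codebook.
Variables (n : nat) (p : 'I_n -> C) (I : finType).
Hypothesis hp : is_distr p.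

Definition cb_prob (f : {ffun I -> 'I_n}) : C := \prod_i p (f i).

Definition cb_mean (F : {ffun I -> 'I_n} -> C) : C := \sum_f cb_prob f * F f.

Lemma cb_prob_ge0 f : 0 <= cb_prob f.
Proof. by apply: prodr_ge0 => i _; apply: hp.1. Qed.

(** Independence of the codewords: expanding the product of sums enumerates the codebooks. *)
Lemma cb_mean_prod (F : I -> 'I_n -> C) :
  cb_mean (fun f => \prod_i F i (f i)) = \prod_i \sum_x p x * F i x.
Proof. by rewrite bigA_distr_bigA; apply: eq_bigr => f _; rewrite -big_split. Qed.

Lemma eq_cb_mean F F' : F =1 F' -> cb_mean F = cb_mean F'.
Proof. by move=> e; apply: eq_bigr => f _; rewrite e. Qed.

Lemma cb_mass : \sum_f cb_prob f = 1.
Proof.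
have := cb_mean_prod (fun _ _ => 1).
rewrite (eq_cb_mean (F' := fun=> 1)) => [|f]; last by rewrite big1.
rewrite /cb_mean (eq_bigr cb_prob) => [->|f _]; last by rewrite mulr1.
apply: big1 => i _ /=; under eq_bigr do rewrite mulr1.
exact: hp.2.
Qed.

Lemma cb_meanD F F' : cb_mean (fun f => F f + F' f) = cb_mean F + cb_mean F'.
Proof. by rewrite -big_split; apply: eq_bigr => f _; rewrite mulrDr. Qed.

Lemma cb_meanZ a F : cb_mean (fun f => a * F f) = a * cb_mean F.
Proof. by rewrite mulr_sumr; apply: eq_bigr => f _; rewrite mulrCA. Qed.

Lemma cb_mean_cst a : cb_mean (fun=> a) = a.
Proof. by rewrite /cb_mean -mulr_suml cb_mass mul1r. Qed.

Lemma cb_mean_sum (J : finType) (Q : pred J) (F : J -> {ffun I -> 'I_n} -> C) :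
  cb_mean (fun f => \sum_(j | Q j) F j f) = \sum_(j | Q j) cb_mean (F j).
Proof. by rewrite exchange_big; apply: eq_bigr => f _; rewrite mulr_sumr. Qed.

Lemma cb_mean1 a (phi : 'I_n -> C) :
  cb_mean (fun f => phi (f a)) = \sum_x p x * phi x.
Proof.
have := cb_mean_prod (fun i x => if i == a then phi x else 1).
rewrite (eq_cb_mean (F' := fun f => phi (f a))) => [->|f]; last first.
  by rewrite (bigD1 a) //= eqxx big1 ?mulr1 // => i /negPf ->.
rewrite (bigD1 a) //= eqxx [X in _ * X]big1 ?mulr1 // => i /negPf ->.
by under eq_bigr do rewrite mulr1; apply: hp.2.
Qed.

Lemma cb_mean2 a b (phi : 'I_n -> 'I_n -> C) : a != b ->
  cb_mean (fun f => phi (f a) (f b)) = \sum_x p x * \sum_y p y * phi x y.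
Proof.
move=> ab.
(* [phi] need not factor, so the value of [f a] is pinned by an indicator; each summand is then a
   product over positions. *)
have -> : cb_mean (fun f => phi (f a) (f b))
        = \sum_x cb_mean (fun f => (f a == x)%:R * phi x (f b)).
  rewrite -cb_mean_sum; apply: eq_cb_mean => f.
  by rewrite (sum_eqr (fun x => phi x (f b))).
apply: eq_bigr => x _.
have := cb_mean_prod (fun i z => if i == a then (z == x)%:R
                                 else if i == b then phi x z else 1).
have ba : (b == a) = false by rewrite eq_sym (negPf ab).
rewrite (eq_cb_mean (F' := fun f => (f a == x)%:R * phi x (f b))) => [->|f]; last first.
  rewrite (bigD1 a) //= eqxx (bigD1 b) ?ba //= eqxx big1 ?mulr1 // => i.
  by case/andP => /negPf -> /negPf ->.
rewrite (bigD1 a) //= eqxx (bigD1 b) ?ba //= eqxx [X in _ * (_ * X)]big1 ?mulr1 => [|i]; last first.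
  case/andP => /negPf -> /negPf ->.
  by under eq_bigr do rewrite mulr1; apply: hp.2.
congr (_ * _); under eq_bigr do rewrite mulrC eq_sym.
by rewrite sum_eqr.
Qed.

End Codebook.
End Expectation.

(** * Average error bound of a random pair of codebooks *)

Section RandomCode.
Variables (C : numClosedFieldType) (nx ny n M1 M2 : nat).
Variables (p : 'I_nx -> C) (q : 'I_ny -> C) (rho : 'I_nx -> 'I_ny -> 'M[C]_n).
Variables (PX PY P0 : 'I_nx -> 'I_ny -> 'M[C]_n) (eps d : C).
Hypotheses (hp : is_distr p) (hq : is_distr q).
Hypothesis hrho : forall x y, is_state (rho x y).
Hypotheses (hX : forall x y, povm_elem (PX x y))
  (hY : forall x y, povm_elem (PY x y)) (h0 : forall x y, povm_elem (P0 x y)).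
Hypotheses (eps_gt0 : 0 < eps) (d_gt0 : 0 < d).

Definition miss (P : 'I_nx -> 'I_ny -> 'M[C]_n) : C :=
  \sum_x \sum_y p x * q y * \tr ((1%:M - P x y) *m rho x y).

Hypotheses (missX : miss PX <= eps) (missY : miss PY <= eps) (miss0 : miss P0 <= eps).
Hypothesis falseX : M1%:R * (2 / eps) * (\sum_x \sum_y p x * q y *
  \tr (PX x y *m \sum_x0 p x0 *: rho x0 y)) <= 1.
Hypothesis falseY : M2%:R * (2 / eps) * (\sum_x \sum_y p x * q y *
  \tr (PY x y *m \sum_y0 q y0 *: rho x y0)) <= 1.
Hypothesis false0 : (M1 * M2)%:R * (2 / eps) * (\sum_x \sum_y p x * q y *
  \tr (P0 x y *m \sum_x0 \sum_y0 (p x0 * q y0) *: rho x0 y0)) <= 1.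

Let mean (F : {ffun 'I_M1 -> 'I_nx} -> {ffun 'I_M2 -> 'I_ny} -> C) :=
  cb_mean p (fun f => cb_mean q (F f)).

Let eq_mean F F' : (forall f g, F f g = F' f g) -> mean F = mean F'.
Proof. by move=> e; apply: eq_cb_mean => f; apply: eq_cb_mean => g. Qed.

Let meanD F F' : mean (fun f g => F f g + F' f g) = mean F + mean F'.
Proof. by rewrite -cb_meanD; apply: eq_cb_mean => f; rewrite cb_meanD. Qed.

Let meanZ a F : mean (fun f g => a * F f g) = a * mean F.
Proof. by rewrite -cb_meanZ; apply: eq_cb_mean => f; rewrite cb_meanZ. Qed.

Let mean_cst a : mean (fun _ _ => a) = a.
Proof.
by rewrite -[RHS](cb_mean_cst 'I_M1 hp); apply: eq_cb_mean => f; rewrite cb_mean_cst.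
Qed.

Let mean_sum (J : finType) (Q : pred J) F :
  mean (fun f g => \sum_(j | Q j) F j f g) = \sum_(j | Q j) mean (F j).
Proof. by rewrite -cb_mean_sum; apply: eq_cb_mean => f; rewrite cb_mean_sum. Qed.

Lemma mean_miss P i j :
  mean (fun f g => \tr ((1%:M - P (f i) (g j)) *m rho (f i) (g j))) = miss P.
Proof.
rewrite /mean; under eq_cb_mean => f.
  rewrite (cb_mean1 hq j (fun y => \tr ((1%:M - P (f i) y) *m rho (f i) y))); over.
rewrite (cb_mean1 hp i (fun x => \sum_y q y * \tr ((1%:M - P x y) *m rho x y))).
by apply: eq_bigr => x _; rewrite mulr_sumr; apply: eq_bigr => y _; rewrite mulrA.
Qed.

Lemma sum_neq_le (k : nat) (a : 'I_k) (b : C) :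
  0 <= b -> \sum_(i < k | i != a) b <= k%:R * b.
Proof.
move=> b0; rewrite mulr_natl -[X in b *+ X](card_ord k) -sumr_const.
by rewrite [leRHS](bigID (fun i => i != a)) /= lerDl sumr_ge0.
Qed.

(** The factor 2 / eps is the loss -1 - log(1/eps) in the rates; it leaves eps / 2 for each kind of
    confusion. *)
Lemma le_half (k b : C) : k * (2 / eps) * b <= 1 -> k * b <= eps / 2.
Proof.
move=> h; rewrite -(ler_pM2r (_ : 0 < 2 / eps)) ?divr_gt0 ?ltr0n // mulrAC.
have -> : eps / 2 * (2 / eps) = 1 by field; rewrite gt_eqF.
by [].
Qed.

(** For i' != i the codewords [f i'] and [f i] are independent while [g j] is shared, so the average
    is the acceptance of rho^X (x) rho^{YZ}. *)
Lemma mean_falseX i j : \sum_(i' | i' != i)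
  mean (fun f g => \tr (PX (f i') (g j) *m rho (f i) (g j))) <= eps / 2.
Proof.
have := falseX; set b := \sum_x _ => false_b.
have E i' : i' != i -> mean (fun f g => \tr (PX (f i') (g j) *m rho (f i) (g j))) = b.
  move=> ii'; rewrite /mean; under eq_cb_mean => f.
    rewrite (cb_mean1 hq j (fun y => \tr (PX (f i') y *m rho (f i) y))); over.
  rewrite (cb_mean2 hp (fun x' x => \sum_y q y * \tr (PX x' y *m rho x y))) //.
  apply: eq_bigr => x _; rewrite mulr_sumr.
  under [RHS]eq_bigr => y _ do
    rewrite mulmx_sumr (raddf_sum (@mxtrace C n)) /= mulr_sumr.
  rewrite exchange_big; apply: eq_bigr => x0 _; rewrite !mulr_sumr.
  by apply: eq_bigr => y _; rewrite -scalemxAr mxtraceZ; ring.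
rewrite (eq_bigr _ E); apply: le_trans (le_half false_b).
apply: sum_neq_le; do 2!apply: sumr_ge0 => ? _.
rewrite mulr_ge0 ?mulr_ge0 ?hp.1 ?hq.1 //.
apply: psd_trM_ge0; first exact: (hX _ _).1.
apply: psd_sum => x _.
by apply: psdZ; [apply: hp.1|apply: (hrho _ _).1].
Qed.

(** Here [f i] is shared and the average is taken in rho^Y (x) rho^{XZ}. *)
Lemma mean_falseY i j : \sum_(j' | j' != j)
  mean (fun f g => \tr (PY (f i) (g j') *m rho (f i) (g j))) <= eps / 2.
Proof.
have := falseY; set b := \sum_x _ => false_b.
have E j' : j' != j -> mean (fun f g => \tr (PY (f i) (g j') *m rho (f i) (g j))) = b.
  move=> jj'; transitivity (cb_mean p (fun f : {ffun 'I_M1 -> 'I_nx} =>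
      \sum_y q y * \sum_y0 q y0 * \tr (PY (f i) y *m rho (f i) y0))).
    apply: eq_cb_mean => f.
    exact: (cb_mean2 hq (fun y' y => \tr (PY (f i) y' *m rho (f i) y))).
  rewrite (cb_mean1 hp i (fun x => \sum_y q y * \sum_y0 q y0 * \tr (PY x y *m rho x y0))).
  apply: eq_bigr => x _; rewrite mulr_sumr; apply: eq_bigr => y _.
  rewrite mulmx_sumr (raddf_sum (@mxtrace C n)) /= !mulr_sumr.
  by apply: eq_bigr => y0 _; rewrite -scalemxAr mxtraceZ; ring.
rewrite (eq_bigr _ E); apply: le_trans (le_half false_b).
apply: sum_neq_le; do 2!apply: sumr_ge0 => ? _.
rewrite mulr_ge0 ?mulr_ge0 ?hp.1 ?hq.1 //.
apply: psd_trM_ge0; first exact: (hY _ _).1.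
apply: psd_sum => y _.
by apply: psdZ; [apply: hq.1|apply: (hrho _ _).1].
Qed.

(** With both codewords independent of the transmitted ones, the average is taken in rho^{XY} (x)
    rho^Z. *)
Lemma mean_false0 i j : \sum_(i' | i' != i) \sum_(j' | j' != j)
  mean (fun f g => \tr (P0 (f i') (g j') *m rho (f i) (g j))) <= eps / 2.
Proof.
have := false0; set b := \sum_x _ => false_b.
have E i' j' : i' != i -> j' != j ->
    mean (fun f g => \tr (P0 (f i') (g j') *m rho (f i) (g j))) = b.
  move=> ii' jj'; transitivity (cb_mean p (fun f : {ffun 'I_M1 -> 'I_nx} =>
      \sum_y q y * \sum_y0 q y0 * \tr (P0 (f i') y *m rho (f i) y0))).
    apply: eq_cb_mean => f.
    exact: (cb_mean2 hq (fun y' y => \tr (P0 (f i') y' *m rho (f i) y))).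
  rewrite (cb_mean2 hp (fun x' x =>
    \sum_y q y * \sum_y0 q y0 * \tr (P0 x' y *m rho x y0))) //.
  apply: eq_bigr => x _; rewrite mulr_sumr.
  under [RHS]eq_bigr => y _ do
    rewrite mulmx_sumr (raddf_sum (@mxtrace C n)) /= mulr_sumr.
  rewrite exchange_big; apply: eq_bigr => x0 _; rewrite !mulr_sumr.
  apply: eq_bigr => y _.
  rewrite mulmx_sumr (raddf_sum (@mxtrace C n)) /= !mulr_sumr.
  by apply: eq_bigr => y0 _; rewrite -scalemxAr mxtraceZ; ring.
have b0 : 0 <= b.
  rewrite /b; do 2!apply: sumr_ge0 => ? _; rewrite mulr_ge0 ?mulr_ge0 ?hp.1 ?hq.1 //.
  apply: psd_trM_ge0; first exact: (h0 _ _).1.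
do 2!apply: psd_sum => ? _.
  by apply: psdZ; [rewrite mulr_ge0 ?hp.1 ?hq.1|apply: (hrho _ _).1].
rewrite (eq_bigr (fun=> \sum_(j' | j' != j) b)) => [|i' ii']; last first.
  by apply: eq_bigr => j' jj'; apply: E.
apply: le_trans (le_half false_b); rewrite natrM -mulrA.
apply: le_trans (sum_neq_le _ (sumr_ge0 _ _)) _ => //.
by rewrite ler_wpM2l ?ler0n // sum_neq_le.
Qed.

Definition code_bound (f : {ffun 'I_M1 -> 'I_nx}) (g : {ffun 'I_M2 -> 'I_ny}) i j :=
  packing_bound (fun i j => PX (f i) (g j)) (fun i j => PY (f i) (g j))
    (fun i j => P0 (f i) (g j)) d i j.

(** Three tests each miss at most eps and three confusions each cost at most eps / 2: 144 = 3 * 48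
    and 24 = 16 * 3 / 2. *)
Lemma mean_code_bound i j :
  mean (fun f g => \tr (code_bound f g i j *m rho (f i) (g j)))
    <= 144 / d * eps + 4 * d + 24 * eps.
Proof.
rewrite (eq_mean (F' := fun f g =>
  48 / d * (\tr ((1%:M - PX (f i) (g j)) *m rho (f i) (g j))
            + \tr ((1%:M - PY (f i) (g j)) *m rho (f i) (g j))
            + \tr ((1%:M - P0 (f i) (g j)) *m rho (f i) (g j)))
  + 4 * d
  + 16 * (\sum_(i' | i' != i) \tr (PX (f i') (g j) *m rho (f i) (g j))
         + \sum_(j' | j' != j) \tr (PY (f i) (g j') *m rho (f i) (g j))
         + \sum_(i' | i' != i) \sum_(j' | j' != j)
             \tr (P0 (f i') (g j') *m rho (f i) (g j))))); last first.
  move=> f g; rewrite /code_bound /packing_bound; set r := rho _ _.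
  have D (A B : 'M[C]_n) : \tr ((A + B) *m r) = \tr (A *m r) + \tr (B *m r).
    by rewrite mulmxDl linearD.
  have Z a (A : 'M[C]_n) : \tr ((a *: A) *m r) = a * \tr (A *m r).
    by rewrite -scalemxAl mxtraceZ.
  have S (J : finType) (Q : pred J) (F : J -> 'M[C]_n) :
      \tr ((\sum_(k | Q k) F k) *m r) = \sum_(k | Q k) \tr (F k *m r).
    by rewrite mulmx_suml (raddf_sum (@mxtrace C n)).
  rewrite 2!D !Z mul1mx (hrho _ _).2 mulr1; congr (_ * _ + _ + _ * _).
    by rewrite 2!D.
  by rewrite 2!D !S; congr (_ + _); apply: eq_bigr => i' _; rewrite S.
rewrite !meanD !meanZ !meanD mean_cst !mean_miss !mean_sum.
have := mean_false0 i j; under eq_bigr do rewrite -mean_sum; move=> F0.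
have le1 : miss PX + miss PY + miss P0 <= 3 * eps.
  by rewrite (_ : 3 * eps = eps + eps + eps) ?lerD //; ring.
have le2 := lerD (lerD (mean_falseX i j) (mean_falseY i j)) F0.
have -> : 144 / d * eps + 4 * d + 24 * eps
   = 48 / d * (3 * eps) + 4 * d + 16 * (eps / 2 + eps / 2 + eps / 2).
  by field; rewrite gt_eqF.
apply: lerD; last by rewrite ler_wpM2l ?ler0n.
by rewrite lerD2r ler_wpM2l // divr_ge0 ?ler0n ?ltW.
Qed.

Lemma exists_good_codebook : exists f g,
  \sum_i \sum_j \tr (code_bound f g i j *m rho (f i) (g j))
    <= (M1 * M2)%:R * (144 / d * eps + 4 * d + 24 * eps).
Proof.
set K := _ * (_ + _).
have K_real : K \is Num.real.
  by rewrite ger0_real // !(mulr_ge0, addr_ge0, ler0n, invr_ge0, ltW d_gt0, ltW eps_gt0).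
pose B (fg : {ffun 'I_M1 -> 'I_nx} * {ffun 'I_M2 -> 'I_ny}) :=
  \sum_i \sum_j \tr (code_bound fg.1 fg.2 i j *m rho (fg.1 i) (fg.2 j)).
suff [[f g] le] : exists fg, B fg <= K by exists f, g.
apply: (exists_le_mean (w := fun fg => cb_prob p fg.1 * cb_prob q fg.2)) => //.
- by move=> fg; rewrite mulr_ge0 ?cb_prob_ge0.
- by rewrite -(pair_bigA _ (fun f g => cb_prob p f * cb_prob q g)) -big_distrlr /=
             !cb_mass // mulr1.
(* Realness follows from positivity of every summand of the bound. *)
- move=> [f g]; rewrite ger0_real //; do 2!apply: sumr_ge0 => ? _.
  apply: psd_trM_ge0; last exact: (hrho _ _).1.
  have d0 := ltW d_gt0.
  apply: psdD; first apply: psdD.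
  + apply: psdZ; first by rewrite divr_ge0 ?ler0n.
    by apply: psdD; [apply: psdD|]; [apply: (hX _ _).2|apply: (hY _ _).2|apply: (h0 _ _).2].
  + by apply: psdZ; [rewrite mulr_ge0 ?ler0n|apply: psd1].
  + apply: psdZ; first exact: ler0n.
    apply: psdD; first apply: psdD.
    * by apply: psd_sum => k _; apply: (hX _ _).1.
    * by apply: psd_sum => k _; apply: (hY _ _).1.
    * by do 2!apply: psd_sum => ? _; apply: (h0 _ _).1.
rewrite -(pair_bigA _ (fun f g => cb_prob p f * cb_prob q g * B (f, g))) /=.
have -> : \sum_f \sum_g cb_prob p f * cb_prob q g * B (f, g)
    = mean (fun f g => \sum_i \sum_j \tr (code_bound f g i j *m rho (f i) (g j))).
  by apply: eq_bigr => f _; rewrite mulr_sumr; apply: eq_bigr => g _; rewrite mulrA.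
rewrite mean_sum.
apply: (@le_trans _ _ (\sum_(i < M1) \sum_(j < M2)
    (144 / d * eps + 4 * d + 24 * eps))).
  apply: ler_sum => i _; rewrite mean_sum; apply: ler_sum => j _.
  exact: mean_code_bound.
by rewrite !sumr_const !card_ord -mulrnA mulnC /K [leRHS]mulr_natl.
Qed.

End RandomCode.

(** * From a sub-POVM to a code, and the choice of parameters *)

(** The missing weight [Rem] is shared equally among all outcomes, which can only lower the
    error. *)
Lemma MAC_code_complete (C : numClosedFieldType) (dX dY dZ M1 M2 : nat)
  (Phi : 'M[C]_(dX * dY) -> 'M[C]_dZ) (al : 'I_M1 -> 'M[C]_dX)
  (be : 'I_M2 -> 'M[C]_dY) (La : 'I_M1 -> 'I_M2 -> 'M[C]_dZ) (eta : C) :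
  is_channel Phi -> (0 < M1)%N -> (0 < M2)%N ->
  (forall i, is_state (al i)) -> (forall j, is_state (be j)) ->
  (forall i j, psd (La i j)) -> psd (1%:M - \sum_i \sum_j La i j) ->
  \sum_i \sum_j \tr ((1%:M - La i j) *m Phi (kron (al i) (be j)))
    <= (M1 * M2)%:R * eta ->
  MAC_code M1 M2 Phi eta.
Proof.
move=> hPhi M1_gt0 M2_gt0 hal hbe psdLa sumLa le.
have M_gt0 : 0 < (M1 * M2)%:R :> C by rewrite ltr0n muln_gt0 M1_gt0.
set Rem := 1%:M - _ in sumLa.
have psdRem : psd ((M1 * M2)%:R^-1 *: Rem) by apply: psdZ => //; rewrite invr_ge0 ltW.
exists al, be, (fun i j => La i j + (M1 * M2)%:R^-1 *: Rem); split=> //.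
- by move=> i j; apply: psdD.
- under eq_bigr do rewrite big_split /= sumr_const card_ord.
  rewrite big_split /= sumr_const card_ord -mulrnA [(M2 * M1)%N]mulnC -scaler_nat scalerA.
  by rewrite mulfV ?gt_eqF // scale1r addrC subrK.
rewrite mulrC ler_pdivrMr // [leRHS]mulrC; apply: le_trans le.
apply: ler_sum => i _; apply: ler_sum => j _.
rewrite -subr_ge0 -raddfB -mulmxBl.
have -> : 1%:M - La i j - (1%:M - (La i j + (M1 * M2)%:R^-1 *: Rem))
        = (M1 * M2)%:R^-1 *: Rem.
  by rewrite opprB addrC addrA subrK addrC addKr.
apply: psd_trM_ge0 => //.
by have [] : is_state (Phi (kron (al i) (be j))) by apply/state_channel/state_kron.
Qed.

(** With M1 = 2^R1 the condition R1 <= I - 1 - log(1/eps) reads M1 * (2 / eps) <= 2^I, whence the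
    last argument of [DH_ge]; likewise for [M2] and the product. *)
Theorem theorem1 (C : numClosedFieldType) (dX dY dZ nx ny : nat)
  (Phi : 'M[C]_(dX * dY) -> 'M[C]_dZ) (hPhi : is_channel Phi)
  (sx : 'I_nx -> 'M[C]_dX) (sy : 'I_ny -> 'M[C]_dY)
  (hsx : forall x, is_state (sx x)) (hsy : forall y, is_state (sy y))
  (p : 'I_nx -> C) (q : 'I_ny -> C) (hp : is_distr p) (hq : is_distr q)
  (eps : C) (heps0 : 0 < eps) (heps1 : eps < 1)
  (M1 M2 : nat) (hM1 : (0 < M1)%N) (hM2 : (0 < M2)%N) :
  let rho := cq_state p q sx sy Phi in
  DH_ge eps rho (marg_X_YZ rho) (M1%:R * (2 / eps)) ->
  DH_ge eps rho (marg_Y_XZ rho) (M2%:R * (2 / eps)) ->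
  DH_ge eps rho (marg_XY_Z rho) ((M1 * M2)%:R * (2 / eps)) ->
  MAC_code M1 M2 Phi (49%:R * sqrtC eps).
Proof.
move=> rho HX HY H0.
pose out x y := Phi (kron (sx x) (sy y)).
have hout x y : is_state (out x y) by apply/state_channel/state_kron.
have tr_out x y : \tr (out x y) = 1 by case: (hout x y).
have s_gt0 : 0 < sqrtC eps by rewrite sqrtC_gt0.
have epsE : eps = sqrtC eps * sqrtC eps by rewrite -expr2 sqrtCK.
set s := sqrtC eps in s_gt0 epsE *.
have s_real : 49 * s \is Num.real by rewrite ger0_real // mulr_ge0 ?ler0n ?ltW.
(* If 49 s >= 1, constant encoders and the zero sub-POVM, of error 1, are enough; the alphabets are
   nonempty because the distributions sum to 1. *)
have [s_big|s_small] := real_leP (real1 C) s_real.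
  have ex k (r : 'I_k -> C) : is_distr r -> exists i : 'I_k, true.
    case: k r => [r [_]|k r _]; last by exists ord0.
    by rewrite big_ord0 => /eqP; rewrite eq_sym oner_eq0.
  have [[x0 _] [y0 _]] := (ex _ _ hp, ex _ _ hq).
  apply: (@MAC_code_complete _ _ _ _ _ _ _ (fun=> sx x0) (fun=> sy y0) (fun _ _ => 0)) => //.
  - by move=> _ _; apply: psd0.
  - by rewrite big1 ?subr0 => [|i _]; [apply: psd1|rewrite big1].
  under eq_bigr do under eq_bigr do rewrite subr0 mul1mx tr_out.
  rewrite !sumr_const !card_ord -mulrnA mulnC -[leLHS]mulr1.
  by rewrite ler_wpM2l ?ler0n.
have [PX [hPX missX falseX]] :=
  DH_diag_blocks hp hq tr_out (blockdiag_X_YZ p hq tr_out) HX.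
have [PY [hPY missY falseY]] :=
  DH_diag_blocks hp hq tr_out (blockdiag_Y_XZ q hp tr_out) HY.
have [P0 [hP0 miss0 false0]] :=
  DH_diag_blocks hp hq tr_out (blockdiag_XY_Z p q tr_out) H0.
(* This value balances 144 eps / d and 4 d, both equal to 24 s. *)
pose d := 6 * s.
have d_gt0 : 0 < d by rewrite mulr_gt0 ?ltr0n.
have d_le1 : d <= 1.
  apply: le_trans (ltW s_small); rewrite ler_wpM2r ?(ltW s_gt0) //.
  by rewrite ler_nat.
have [f [g le]] := exists_good_codebook hp hq hout hPX hPY hP0 heps0 d_gt0
  missX missY miss0 falseX falseY false0.
have [La [psdLa sumLa leLa]] := packing (fun i j => hPX (f i) (g j))
  (fun i j => hPY (f i) (g j)) (fun i j => hP0 (f i) (g j)) d_gt0 d_le1.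
apply: (@MAC_code_complete _ _ _ _ _ _ _ (fun i => sx (f i)) (fun j => sy (g j)) La) => //.
apply: le_trans (_ : (M1 * M2)%:R * (144 / d * eps + 4 * d + 24 * eps) <= _).
  apply: le_trans le; apply: ler_sum => i _; apply: ler_sum => j _.
  rewrite -subr_ge0 -raddfB -mulmxBl; apply: psd_trM_ge0; first exact: leLa.
  by case: (hout (f i) (g j)).
rewrite ler_wpM2l ?ler0n //.
have -> : 144 / d * eps + 4 * d + 24 * eps = (48 + 24 * s) * s.
  by rewrite epsE /d; field; rewrite gt_eqF.
(* The remaining 24 s is at most 49 s < 1, so 48 + 24 s <= 49. *)
rewrite ler_wpM2r ?(ltW s_gt0) // -[49%:R]/((48 + 1)%:R) natrD lerD2l.
apply: le_trans (ltW s_small); rewrite ler_wpM2r ?(ltW s_gt0) //.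
by rewrite ler_nat.
Qed.
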